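(* Let $\varphi:\overline{\mathbb{B}^m}\to\mathbb{R}^m$ be a $C^1$ map, not necessarily injective, and let $\mathcal{S}:=\varphi(\partial\mathbb{B}^m)$ be the cycle it defines. For every $C^1$ vector field $\mathbf{F}:\mathbb{R}^m\to\mathbb{R}^m$, $$\oint_{\mathcal{S}}\mathbf{F}(\mathbf{p})\cdot\mathbf{n}_{\mathcal{S}}(\mathbf{z}_{\mathbf{p}})\,d\mathbf{p}=\int_{\mathbb{B}^m}(\nabla\cdot\mathbf{F})(\varphi(\mathbf{x}))\,J_\varphi(\mathbf{x})\,d\mathbf{x},$$ where $J_\varphi$ is the determinant of the Jacobian matrix of $\varphi$ and $\mathbf{n}_{\mathcal{S}}$ is the outward normal of the cycle $\mathcal{S}$.
   Context: $m\ge2$ and $\mathbb{B}^m:=(0,1)^m$ is the open $m$-cube. A wedge product of $m$ vectors of $\mathbb{R}^m$ is identified with the determinant of the matrix having these vectors as its columns in order. Outward normal of the cycle $\psi=\varphi|_{\partial\mathbb{B}^m}$: at a point $\mathbf{z}\in\partial\mathbb{B}^m$ with $z_i=s$, $s\in\{0,1\}$, and all other coordinates in $(0,1)$, it is the unit vector $\mathbf{n}_{\mathcal{S}}(\mathbf{z})$ orthogonal to $\partial_{z_k}\psi(\mathbf{z})$ for all $k\neq i$ such that $\left(\bigwedge_{k=1}^{i-1}\partial_{z_k}\psi\right)\wedge\mathbf{n}_{\mathcal{S}}\wedge\left(\bigwedge_{k=i+1}^{m}\partial_{z_k}\psi\right)$ is $\le0$ if $s=0$ and $\ge0$ if $s=1$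 (equality occurs only at singular points, which do not contribute to the integral). The integral over the cycle is parametric: $\oint_{\mathcal{S}}\mathbf{F}\cdot\mathbf{n}_{\mathcal{S}}\,d\mathbf{p}$ is the sum over the $2m$ open faces of $\partial\mathbb{B}^m$ of $\int\mathbf{F}(\varphi(\mathbf{z}))\cdot\mathbf{n}_{\mathcal{S}}(\mathbf{z})\,dA(\mathbf{z})$, with $dA$ the $(m-1)$-dimensional area element induced by $\varphi$ on that face; $\mathbf{z}_{\mathbf{p}}$ denotes the parameter of the point $\mathbf{p}$, and self-overlaps are counted with multiplicity. *)

(* Defs.v *)
From HB Require Import structures.
From mathcomp Require Import all_boot all_order all_algebra.
From mathcomp Require Import all_classical all_reals all_analysis.

Set Implicit Arguments.
Unset Strict Implicit.
Unset Printing Implicit Defensive.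
Import Order.TTheory GRing.Theory Num.Theory.
Import numFieldNormedType.Exports.
Local Open Scope classical_set_scope.
Local Open Scope ring_scope.

Section cons_measure.
Context (R : realType) (n : nat).
Local Notation TR := (measurableTypeR R).
Variable mu : {sigma_finite_measure set (n.-tuple TR) -> \bar R}.

Definition cons_pair (p : TR * n.-tuple TR) : n.+1.-tuple TR :=
  [tuple of p.1 :: p.2].

Lemma measurable_cons_pair : measurable_fun setT cons_pair.
Proof. exact: (measurable_cons measurable_fst measurable_snd). Qed.

HB.instance Definition _ := isMeasurableFun.Build _ _ _ _ cons_pair
  measurable_cons_pair.

Definition cons_measure : set (n.+1.-tuple TR) -> \bar R :=
  pushforward (@lebesgue_measure R \x mu)%E cons_pair.

Let cons_measure0 : cons_measure set0 = 0%E.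
Proof. by rewrite /cons_measure /pushforward preimage_set0 measure0. Qed.

Let cons_measure_ge0 A : (0 <= cons_measure A)%E.
Proof. exact: measure_ge0. Qed.

Let cons_measure_sigma_additive : semi_sigma_additive cons_measure.
Proof.
exact: (@measure_semi_sigma_additive _ _ _
  (@pushforward _ _ _ _ _ (@lebesgue_measure R \x mu)%E
     (cons_pair : {mfun _ >-> _}))).
Qed.

HB.instance Definition _ := isMeasure.Build _ _ _ cons_measure
  cons_measure0 cons_measure_ge0 cons_measure_sigma_additive.

Let cons_measure_sigma_finite : sigma_finite setT cons_measure.
Proof.
have /sigma_finiteP[F [TF ndF Foo]] := sigma_finiteT (@lebesgue_measure R).
have /sigma_finiteP[G [TG ndG Goo]] := sigma_finiteT mu.
pose h (t : n.+1.-tuple TR) : TR * n.-tuple TR :=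
  (tnth t ord0, [tuple of behead t]).
have mh : measurable_fun setT h.
  apply/measurable_fun_pairP; split; first exact: measurable_tnth.
  exact: measurable_behead.
exists (fun k => h @^-1` (F k `*` G k)).
  rewrite -preimage_bigcup (_ : \bigcup_k _ = setT) ?preimage_setT//.
  rewrite -subTset => -[x y] _.
  have : setT x by []; rewrite TF => -[k _ Fkx].
  have : setT y by []; rewrite TG => -[l _ Gly].
  exists (maxn k l) => //; split => /=.
    by move: x Fkx; exact/subsetPset/ndF/leq_maxl.
  by move: y Gly; exact/subsetPset/ndG/leq_maxr.
move=> k; have [mF Fk] := Foo k; have [mG Gk] := Goo k; split.
  by rewrite -[X in measurable X]setTI; apply: mh => //; exact: measurableX.
rewrite /cons_measure /pushforward -comp_preimage.
rewrite (_ : h \o cons_pair = id); last first.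
  by apply/funext => -[x t]; congr (_, _); apply/val_inj.
by rewrite preimage_id product_measure1E// lte_mul_pinfty// ge0_fin_numE.
Qed.

HB.instance Definition _ := Measure_isSigmaFinite.Build _ _ _ cons_measure
  cons_measure_sigma_finite.
End cons_measure.

Fixpoint lebesgue_tuple (R : realType) (n : nat) :
    {sigma_finite_measure set (n.-tuple (measurableTypeR R)) -> \bar R} :=
  match n with
  | 0 => dirac [tuple]
  | n'.+1 => cons_measure (lebesgue_tuple R n')
  end.

Lemma lebesgue_tuple_box (R : realType) (n : nat)
    (A : 'I_n -> set (measurableTypeR R)) :
  (forall i, measurable (A i)) ->
  lebesgue_tuple R n [set t | forall i, A i (tnth t i)] =
  (\prod_(i < n) lebesgue_measure (A i))%E.
Proof.
elim: n A => [|n IH] A mA.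
  by rewrite big_ord0 /= diracE mem_set//= => -[].
have mbox : measurable [set t : n.-tuple (measurableTypeR R) |
    forall i, A (lift ord0 i) (tnth t i)].
  rewrite [X in measurable X](_ : _ = \big[setI/setT]_(i <- index_enum 'I_n)
    ((fun t => tnth t i) @^-1` A (lift ord0 i))).
    apply: bigsetI_measurable => i _.
    by rewrite -[X in measurable X]setTI; exact: measurable_tnth.
  apply/seteqP; split => t /=; rewrite -bigcap_seq => tA.
    by move=> i _; exact: tA.
  by move=> i; apply: tA; rewrite /= mem_index_enum.
rewrite big_ord_recl -IH//= /cons_measure /pushforward.
rewrite -product_measure1E//; congr (product_measure1 _ _ _).
apply/seteqP; split => -[x t] /=.
  move=> tA; split; first exact: (tA ord0).
  by move=> i; have := tA (lift ord0 i); rewrite tnthS.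
move=> [Ax tA] i; have [j ->|->] := unliftP ord0 i; first by rewrite tnthS; exact: tA.
exact: Ax.
Qed.

(* R^m is 'rV[R]_m; integration variables range over tuples, which carry the
   product sigma-algebra. *)
Definition row_tuple (R : realType) (n : nat)
    (t : n.-tuple (measurableTypeR R)) : 'rV[R]_n := \row_i tnth t i.

Definition unit_cube (R : realType) (n : nat) :
    set (n.-tuple (measurableTypeR R)) :=
  [set t | forall i, 0 < tnth t i < 1].
Arguments unit_cube : clear implicits.

Definition closed_cube (R : realType) (m : nat) : set 'rV[R]_m :=
  [set x | forall i, 0 <= x 0 i <= 1].
Arguments closed_cube : clear implicits.

Section parametric_cycle.
Context (R : realType) (m : nat).
Implicit Types (f F : 'rV[R]_m -> 'rV[R]_m) (x z : 'rV[R]_m) (i : 'I_m).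

(* C^1 on a set that need not be open: Frechet differentiable relatively to A
   at every point of A, with a derivative continuous on A. As for [jacobian],
   the matrix of the derivative acts on the right of row vectors. *)
Definition C1_on (A : set 'rV[R]_m) f : Prop :=
  exists Df : 'rV[R]_m -> 'M[R]_m,
    {within A, continuous Df} /\
    forall x, A x -> forall e : R, 0 < e ->
      \forall y \near within A (nbhs x),
        `|f y - f x - (y - x) *m Df x| <= e * `|y - x|.

Definition partial f i x : 'rV[R]_m := 'D_(delta_mx 0 i) f x.

Definition divergence F x : R :=
  \sum_(i < m) 'D_(delta_mx 0 i) (fun y => F y 0 i) x.

Definition dotr (u v : 'rV[R]_m) : R := \sum_(i < m) u 0 i * v 0 i.

Definition wedge (v : 'I_m -> 'rV[R]_m) : R := \det (\matrix_(a, k) v k 0 a).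

Definition open_face i (s : bool) : set 'rV[R]_m :=
  [set z | z 0 i = s%:R /\ forall k, k != i -> 0 < z 0 k < 1].

(* Chart of [open_face i s] by the open cube of dimension m - 1: insert s as
   the i-th coordinate. *)
Definition face_point i (s : bool) (t : m.-1.-tuple (measurableTypeR R)) :
    'rV[R]_m :=
  \row_j (if unlift i j is Some k then tnth t k else s%:R).

(* On the open face z_i = s the partial derivatives in the directions k != i
   only involve the values of phi on that face. *)
Definition outward_normal_at (phi : 'rV[R]_m -> 'rV[R]_m) i (s : bool) z
    (v : 'rV[R]_m) : Prop :=
  [/\ dotr v v = 1,
      forall k, k != i -> dotr v (partial phi k z) = 0 &
      let w := wedge (fun k => if k == i then v else partial phi k z) in
      if s then 0 <= w else w <= 0].

(* At singular points the normal is not unique: any choice is accepted. *)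
Definition outward_normal (phi nS : 'rV[R]_m -> 'rV[R]_m) : Prop :=
  forall i s z, open_face i s z -> outward_normal_at phi i s z (nS z).

(* Square root of the Gram determinant of the tangent vectors of the face. *)
Definition area_density (phi : 'rV[R]_m -> 'rV[R]_m) i z : R :=
  Num.sqrt (\det (\matrix_(a < m.-1, b < m.-1)
    dotr (partial phi (lift i a) z) (partial phi (lift i b) z))).

Definition cycle_flux (phi nS F : 'rV[R]_m -> 'rV[R]_m) : R :=
  \sum_(i < m) \sum_(s : bool)
    \int[lebesgue_tuple R m.-1]_(t in unit_cube R m.-1)
      (let z := face_point i s t in
       dotr (F (phi z)) (nS z) * area_density phi i z).

End parametric_cycle.

(* Main.v *)
(* Write the flux integrand as [+- F . N], where N is the vector of cofactors
   of the face index in the Jacobian matrix.  With u_a the a-th component of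
   F \o phi, the theorem is then the sum over a of Stokes' identity
     \int det D(phi with phi_a replaced by u_a) = boundary sum of u_a * cofactor.
   For polynomial maps that identity follows from the Piola identity, i.e.
   that the cofactor fields are divergence free.  A C^1 map is only once
   differentiable, but its Bernstein polynomials converge to it together with
   their first derivatives, boundedly on the closed cube, so that dominated
   convergence transfers the identity. *)

(* On a face [phi] has no two-sided derivative across that face, so only tangential rows of [Df] can
   be used there. This is enough: the cofactors of row i delete row i, and a difference quotient in
   direction k inside the cube calls for a derivative only at points whose k-th coordinate is
   interior. The normal is an arbitrary choice at singular points and nothing is known about its
   measurability. The flux integrand is therefore replaced pointwise by its cofactor form before
   anything is integrated; at singular points both forms vanish. Measurability and integrability of
   the cofactor form, and of the volume integrand, then come from the same polynomial approximation,
   polynomials being visibly measurable on tuples. *)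
Require Import Defs.
From mathcomp Require Import all_boot all_order all_algebra.
From mathcomp Require Import all_classical all_reals all_analysis.
From mathcomp Require Import perm measurable_realfun ring lra.
From mathcomp Require Import -(notations) mpoly.
Set Implicit Arguments.
Unset Strict Implicit.
Unset Printing Implicit Defensive.
Import Order.TTheory GRing.Theory Num.Theory.
Import numFieldNormedType.Exports.
Local Open Scope classical_set_scope.
Local Open Scope ring_scope.

(** * The Piola identity *)

Section derivation.
Context (A : comNzRingType) (n : nat).

Lemma derivation_prod (D : {additive A -> A}) (f : 'I_n -> A) :
    (forall p q, D (p * q) = D p * q + p * D q) ->
  D (\prod_i f i) = \sum_k \prod_i (if i == k then D (f i) else f i).
Proof.
move=> DM; have D1 : D 1 = 0.
  by have := DM 1 1; rewrite !mul1r mulr1 -{1}[D 1]addr0 => /addrI ->.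
elim: n f => [|p IH] f; first by rewrite !big_ord0.
rewrite big_ord_recl DM IH [RHS]big_ord_recl; congr (_ + _).
  by rewrite big_ord_recl eqxx.
rewrite mulr_sumr; apply: eq_bigr => k _; rewrite [RHS]big_ord_recl /=.
by congr (_ * _); apply: eq_bigr => i _; rewrite (inj_eq lift_inj).
Qed.

Lemma derivation_det (D : {additive A -> A}) (M : 'M[A]_n) :
    (forall p q, D (p * q) = D p * q + p * D q) ->
  D (\det M) =
  \sum_k \det (\matrix_(i, j) (if i == k then D (M i j) else M i j)).
Proof.
move=> DM; rewrite /determinant raddf_sum [RHS]exchange_big /=.
apply: eq_bigr => s _; rewrite -mulr_sumr.
transitivity ((-1) ^+ s * D (\prod_i M i (s i))).
  by case: (odd_perm s); rewrite ?expr1 ?expr0 ?mulN1r ?mul1r ?raddfN.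
rewrite (derivation_prod _ DM); congr (_ * _).
by apply: eq_bigr => k _; apply: eq_bigr => i _; rewrite mxE.
Qed.

(** The matrix keeps its size, so that the Leibniz rule, limits, bounds and measurability of
    determinants pass directly to cofactors. *)
Lemma cofactor_det (M : 'M[A]_n) i a :
  cofactor M i a =
  \det (\matrix_(k, b) (if k == i then (b == a)%:R else M k b)).
Proof.
rewrite (expand_det_row _ i) (bigD1 a) //= mxE !eqxx mul1r big1 => [|b ba].
  rewrite addr0; congr (_ * \det _); apply/matrixP => k b; rewrite !mxE.
  by rewrite eq_sym (negPf (neq_lift _ _)).
by rewrite mxE eqxx (negPf ba) mul0r.
Qed.

(* The mixed second derivatives form a matrix T with [T i k = - T k i]. *)
Lemma piola (d : 'I_n -> {additive A -> A}) (P : 'I_n -> A) a :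
    (forall i p q, d i (p * q) = d i p * q + p * d i q) ->
    (forall i j p, d i (d j p) = d j (d i p)) ->
  \sum_i d i (cofactor (\matrix_(k, b) d k (P b)) i a) = 0.
Proof.
move=> dM dC; have d1 i : d i 1 = 0.
  by have := dM i 1 1; rewrite !mul1r mulr1 -{1}[d i 1]addr0 => /addrI ->.
(* The part of [d i] of the cofactor at (i, a) in which the derivation hits row k. The part that
   hits row i vanishes, since that row is constant. *)
pose T (i k : 'I_n) : A := \det (\matrix_(l, b)
  (if l == k then d i (d l (P b))
   else if l == i then (b == a)%:R else d l (P b))).
have TN i k : i != k -> T i k = - T k i.
  move=> ik; rewrite /T -[RHS]mulN1r -[- 1](_ : (-1) ^+ tperm i k = _); last first.
    by rewrite odd_tperm ik expr1.
  have ki : (k == i) = false by rewrite eq_sym (negPf ik).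
  rewrite -det_perm -det_mulmx -row_permE; congr (\det _).
  apply/matrixP => l b; rewrite !mxE.
  case: tpermP => [->|->|/eqP li /eqP lk].
  - by rewrite (negPf ik) ki !eqxx.
  - by rewrite ki !eqxx dC.
  by rewrite (negPf li) (negPf lk).
have -> : \sum_i d i (cofactor (\matrix_(k, b) d k (P b)) i a) =
    \sum_i \sum_(k | k != i) T i k.
  apply: eq_bigr => i _; rewrite cofactor_det derivation_det //.
  rewrite (bigD1 i) //= [X in X + _](_ : _ = 0) ?add0r.
    apply: eq_bigr => k ki; congr (\det _); apply/matrixP => l b; rewrite !mxE.
    case: (eqVneq l k) => [->|//]; by rewrite (negPf ki).
  apply/eqP; rewrite (expand_det_row _ i) big1 // => b _.
  by rewrite !mxE eqxx; case: (b == a); rewrite ?d1 ?raddf0 mul0r.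
(* In a ring where 2 may be a zero divisor, S = - S does not give S = 0. The pairs are therefore
   split by order and cancelled one against one. *)
have -> : \sum_i \sum_(k | k != i) T i k =
    \sum_(i < n) \sum_(k < n | (k < i)%N) T i k +
    \sum_(i < n) \sum_(k < n | (i < k)%N) T i k.
  rewrite -big_split; apply: eq_bigr => i _ /=.
  rewrite (bigID (fun k : 'I_n => (k < i)%N)) /=; congr (_ + _).
    by apply: eq_bigl => k; rewrite -val_eqE; case: ltngtP.
  by apply: eq_bigl => k; rewrite -val_eqE; case: ltngtP.
rewrite [X in _ + X](exchange_big_dep predT) //= -big_split big1 //= => i _.
rewrite -big_split big1 //= => k ki.
by rewrite (TN i) ?addNr // -val_eqE gtn_eqF.
Qed.

(** Expansion along column a gives the terms in which [d i] hits [P a]; the remaining terms of the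
    product rule are [P a] times the sum that vanishes by [piola]. *)
Lemma det_divergence (d : 'I_n -> {additive A -> A}) (P : 'I_n -> A) a :
    (forall i p q, d i (p * q) = d i p * q + p * d i q) ->
    (forall i j p, d i (d j p) = d j (d i p)) ->
  \det (\matrix_(k, b) d k (P b)) =
  \sum_i d i (P a * cofactor (\matrix_(k, b) d k (P b)) i a).
Proof.
move=> dM dC; rewrite [LHS](expand_det_col _ a).
under [RHS]eq_bigr do rewrite dM.
rewrite big_split /= -[X in _ = _ + X]mulr_sumr piola // mulr0 addr0.
by apply: eq_bigr => i _; rewrite mxE.
Qed.
End derivation.

(** * Bernstein operators as averages over lattice walks *)

Section walk.
Context (V : zmodType) (n : nat).

(* Iterating "move by [e k] with weight [X k]" over [ks] and averaging [g] over
   the end points is the Bernstein operator of degree [count_mem k ks] in the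
   k-th variable. *)
Fixpoint walk (A : pzRingType) (X : 'I_n -> A) (e : 'I_n -> V) (ks : seq 'I_n)
    (g : V -> A) (y : V) : A :=
  if ks is k :: ks' then
    X k * walk X e ks' g (y + e k) + (1 - X k) * walk X e ks' g y
  else g y.

(** Steps commute, because displacements add in an abelian group and weights multiply in a
    commutative ring. *)
Lemma walk_rem (A : comNzRingType) (X : 'I_n -> A) e ks g y k :
  k \in ks -> walk X e ks g y = walk X e (k :: rem k ks) g y.
Proof.
elim: ks y => [//|l ks IH] y /=; rewrite inE eq_sym.
case: (eqVneq l k) => [-> //|lk /= kks].
rewrite !(IH _ kks) /= [y + e l + e k]addrAC; ring.
Qed.

Lemma walk_cst (A : comNzRingType) (X : 'I_n -> A) e ks c y :
  walk X e ks (fun=> c) y = c.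
Proof. by elim: ks y => [//|k ks IH] y /=; rewrite !IH; ring. Qed.

Lemma walk_comb (A : comNzRingType) (X : 'I_n -> A) e ks a g1 g2 y :
  walk X e ks (fun z => a * g1 z + g2 z) y =
  a * walk X e ks g1 y + walk X e ks g2 y.
Proof. by elim: ks y => [//|k ks IH] y /=; rewrite !IH; ring. Qed.

Lemma walk_diff (A : comNzRingType) (X : 'I_n -> A) e ks g y k :
  walk X e ks (fun z => g (z + e k) - g z) y =
  walk X e ks g (y + e k) - walk X e ks g y.
Proof.
elim: ks y => [//|l ks IH] y /=; rewrite !IH [y + e l + e k]addrAC; ring.
Qed.

Lemma rmorph_walk (A B : pzRingType) (f : {rmorphism A -> B})
    (X : 'I_n -> A) e ks g y :
  f (walk X e ks g y) = walk (f \o X) e ks (f \o g) y.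
Proof.
by elim: ks y => [//|k ks IH] y /=; rewrite rmorphD !rmorphM rmorphB rmorph1 !IH.
Qed.

(** Differentiating the two weights of a step in direction k turns that step into a difference of
    end values. Since steps commute, each of the [count_mem k ks] such steps contributes the same
    walk. *)
Lemma derivation_walk (A : comNzRingType) (D : {additive A -> A})
    (X : 'I_n -> A) e ks g y k :
    (forall p q, D (p * q) = D p * q + p * D q) ->
    (forall l, D (X l) = (l == k)%:R) -> (forall z, D (g z) = 0) ->
  D (walk X e ks g y) =
  (count_mem k ks)%:R * walk X e (rem k ks) (fun z => g (z + e k) - g z) y.
Proof.
move=> DM DX Dg; have D1 : D 1 = 0.
  by have := DM 1 1; rewrite !mul1r mulr1 -{1}[D 1]addr0 => /addrI ->.
elim: ks y => [|l ks IH] y /=; first by rewrite Dg mul0r.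
rewrite raddfD !DM raddfB D1 DX !IH.
case: (eqVneq l k) => [->|lk] /=; last first.
  by rewrite add0n; move: (count_mem k ks)%:R => c; ring.
have E := walk_diff X e ks g y k.
have [kks|/count_memPn ->] := boolP (k \in ks); last by rewrite E; ring.
rewrite natrD [RHS]mulrDl {1}E (walk_rem X e (fun z => g (z + e k) - g z) y kks) /=.
by move: (count_mem k ks)%:R => c; ring.
Qed.
End walk.

Section walk_real.
Context (R : realFieldType) (n : nat) (h : R) (x : 'I_n -> R).
Local Notation W := (walk x (fun k => h *: delta_mx 0 k : 'rV[R]_n)).

(** Weights in [0, 1] make the average monotone. The comparison is restricted to the box that the
    walk can reach, because the functions averaged later are controlled only on the cube. *)
Lemma ler_walk ks (g1 g2 : 'rV[R]_n -> R) (y : 'rV[R]_n) :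
  0 <= h -> (forall k, 0 <= x k <= 1) ->
  (forall z : 'rV[R]_n,
     (forall l, y 0 l <= z 0 l <= y 0 l + h * (count_mem l ks)%:R) ->
     g1 z <= g2 z) ->
  W ks g1 y <= W ks g2 y.
Proof.
move=> h_ge0 x01; elim: ks y => [|k ks IH] y /= Hg.
  by apply: Hg => l; rewrite mulr0 addr0 lexx.
have /andP[xk0 xk1] := x01 k.
apply: lerD; apply: ler_wpM2l; rewrite ?subr_ge0 //; apply: IH => z Hz;
  apply: Hg => l; have := Hz l; rewrite ?mxE natrD mulrDr /= ?[l == k]eq_sym;
  (have : 0 <= h * (k == l)%:R by rewrite mulr_ge0 // ler0n);
  by move: (h * _) (h * _) => ? ?; lra.
Qed.

(** Squared bias plus variance: the l-th coordinate of the end point is a scaled and shifted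
    binomial variable. *)
Lemma walk_sqr ks (l : 'I_n) (c : R) (y : 'rV[R]_n) :
  W ks (fun z => (z 0 l - c) ^+ 2) y =
  (y 0 l + h * (count_mem l ks)%:R * x l - c) ^+ 2 +
  h ^+ 2 * (count_mem l ks)%:R * (x l * (1 - x l)).
Proof.
elim: ks y => [|k ks IH] y /=; first by ring.
rewrite !IH !mxE natrD eqxx /= [l == k]eq_sym.
by case: (eqVneq k l) => [->|_] /=; ring.
Qed.
End walk_real.

(** * Continuity, quadratic majorants and the mean value theorem on the closed cube *)

Section closed_cube_topology.
Context (R : realType) (n : nat).
Local Notation cube := (closed_cube R n).

Lemma compact_closed_cube : compact cube.
Proof.
have -> : cube = [set v : 'rV[R]_n | forall i, `[0, 1]%classic (v ord0 i)].
  by apply/seteqP; split => x /= + i => /(_ i); rewrite in_itv.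
have := @rV_compact _ n (fun=> `[0 : R, 1]%classic).
apply=> i; exact: segment_compact.
Qed.

Lemma closed_cube_bounded (g : 'rV[R]_n -> R) :
  {within cube, continuous g} ->
  exists2 M, 0 <= M & forall x, cube x -> `|g x| <= M.
Proof.
move=> /continuous_compact /(_ compact_closed_cube) /compact_bounded.
move=> /pinfty_ex_gt0 [M M0 gM]; exists M; first exact: ltW.
by move=> x cx; apply: gM; exists x.
Qed.

(** A Korovkin-type bound: within distance d of x continuity gives [e]; elsewhere some coordinate is
    off by at least d, and the constant 2 M / d^2 makes the quadratic term at least 2 M. Averages of
    that term are known from [walk_sqr]. *)
Lemma closed_cube_majorant (g : 'rV[R]_n -> R) x (e : R) :
    {within cube, continuous g} -> cube x -> 0 < e ->
  exists2 C, 0 <= C & forall y, cube y ->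
    `|g y - g x| <= e + C * \sum_l (y 0 l - x 0 l) ^+ 2.
Proof.
move=> cg cx e0; have [M M0 gM] := closed_cube_bounded cg.
have /subspace_continuousP/(_ x cx)/cvgrPdist_lt/(_ _ e0) := cg.
rewrite near_withinE => /nbhs_ballP[d /= d0 dg].
have C0 : 0 <= 2 * M / d ^+ 2 by rewrite divr_ge0 ?mulr_ge0 ?exprn_ge0 // ltW.
exists (2 * M / d ^+ 2) => // y cy.
have S0 l : 0 <= (y 0 l - x 0 l) ^+ 2 by exact: sqr_ge0.
have [xy|] := pselect (ball x d y).
  rewrite ler_wpDr //; last by rewrite distrC; apply: ltW; exact: dg.
  by rewrite mulr_ge0 // sumr_ge0.
move=> xy; have [l dl] : exists l, d ^+ 2 <= (y 0 l - x 0 l) ^+ 2.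
  apply: contrapT => /forallNP H; apply: xy; split=> // i l.
  rewrite ord1 /ball /= distrC -(ltr_pXn2r (n := 2)) ?nnegrE ?(ltW d0) //.
  by rewrite real_normK ?num_real // ltNge; apply/negP/H.
apply: (@le_trans _ _ (M + M)).
  by rewrite (le_trans (ler_normB _ _)) // lerD // gM.
rewrite ler_wpDl ?(ltW e0) // (_ : M + M = 2 * M / d ^+ 2 * d ^+ 2).
  apply: ler_wpM2l => //; apply: le_trans dl _; rewrite (bigD1 l) //=.
  by rewrite ler_wpDr ?sumr_ge0.
by rewrite divfK ?sqrf_eq0 ?gt_eqF // mulr_natl mulr2n.
Qed.

Lemma is_derive_line (f : 'rV[R]_n -> R) (df : R) (z v : 'rV[R]_n) (t : R) :
  is_derive (z + t *: v) v f df -> is_derive t 1 (fun s : R => f (z + s *: v)) df.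
Proof.
move=> [df1 df2].
have E : (fun h : R => h^-1 *: (((fun s : R => f (z + s *: v)) \o shift t) (h *: 1)
           - f (z + t *: v))) =
         (fun h : R => h^-1 *: ((f \o shift (z + t *: v)) (h *: v) - f (z + t *: v))).
  apply/funext => h /=; congr (_ *: (f _ - _)).
  by rewrite [h *: 1]mulr1 scalerDl addrCA.
by split; [rewrite /derivable E|rewrite /derive E].
Qed.

(* [f] is C^1 along the coordinate directions: at points of the faces only the
   tangential partial derivatives are two-sided. *)
Definition C1_scalar (f : 'rV[R]_n -> R) (Df : 'I_n -> 'rV[R]_n -> R) :=
  [/\ {within cube, continuous f}, forall k, {within cube, continuous Df k} &
      forall k x, cube x -> 0 < x 0 k < 1 -> is_derive x (delta_mx 0 k) f (Df k x)].

(** The segment may end on faces, but its inner points have k-th coordinate strictly between 0 and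
    1, where [C1_scalar] supplies the derivative. *)
Lemma closed_cube_MVT f Df (h : R) (z : 'rV[R]_n) k :
    C1_scalar f Df -> 0 < h -> cube z -> z 0 k + h <= 1 ->
  exists y, [/\ cube y, forall l, `|y 0 l - z 0 l| <= h &
    f (z + h *: delta_mx 0 k) - f z = h * Df k y].
Proof.
move=> [cf cDf dDf] h0 cz zh.
pose L (t : R) : 'rV[R]_n := z + t *: delta_mx 0 k.
have LE t l : L t 0 l = z 0 l + t * (l == k)%:R by rewrite !mxE eqxx.
have cL t : 0 <= t <= h -> cube (L t).
  move=> th l; rewrite LE; have := cz l; case: (eqVneq l k) => [->|_] /=;
    rewrite ?mulr1 ?mulr0; lra.
have [||t] := @MVT _ (fun t => f (L t)) (fun t => Df k (L t)) 0 h h0.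
- move=> t; rewrite in_itv /= => th; apply: is_derive_line; apply: dDf.
    by apply: cL; lra.
  by rewrite LE eqxx mulr1; have := cz k; lra.
- apply/subspace_continuousP => t; rewrite /= in_itv /= => th.
  have Lc : L @ t --> L t.
    rewrite /L; apply: (@cvgD _ _ _ _ _ (cst z) (fun s : R => s *: delta_mx 0 k)).
      exact: cvg_cst.
    exact: scalel_continuous.
  move=> A /((subspace_continuousP _ _).1 cf _ (cL _ th)) /Lc.
  move=> H; have {}H : \forall s \near t, cube (L s) -> A (f (L s)) := H.
  suff: \forall s \near t, `[0, h]%classic s -> A (f (L s)) by [].
  by apply: filterS H => s As; rewrite /= in_itv /= => sh; apply: As; exact: cL.
rewrite in_itv /= => th E; exists (L t); split.
- by apply: cL; lra.
- move=> l; rewrite LE addrAC subrr add0r.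
  by case: (l == k); rewrite ?mulr1 ?mulr0 ?normr0 ?(ltW h0) // gtr0_norm; lra.
- by move: E; rewrite /L scale0r addr0 subr0 mulrC.
Qed.
End closed_cube_topology.

(** * Convergence of Bernstein polynomials and of their first derivatives *)

Section bernstein.
Context (R : realType) (n : nat).
Local Notation cube := (closed_cube R n).
Implicit Types (f g : 'rV[R]_n -> R) (x y z : 'rV[R]_n).

Fixpoint sweeps (N : nat) : seq 'I_n :=
  if N is N'.+1 then enum 'I_n ++ sweeps N' else [::].

Lemma count_sweeps N k : count_mem k (sweeps N) = N.
Proof.
elim: N => [//|N IH]; rewrite /= count_cat IH count_uniq_mem ?enum_uniq //.
by rewrite mem_enum.
Qed.

Definition mesh (N : nat) (k : 'I_n) : 'rV[R]_n := N.+1%:R^-1 *: delta_mx 0 k.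

(** The degree in each variable is N + 1, which keeps the mesh 1 / (N + 1) defined at N = 0. The
    sampled values of [f] are constant polynomials; the variables occur only in the weights. *)
Definition bernstein N f : mpoly n R :=
  walk (fun k => mpolyX R (mnm1 k)) (mesh N) (sweeps N.+1)
    (fun y => mpolyC n (f y)) 0.

Lemma meval_walkX N ks g x :
  meval (x 0) (walk (fun k => mpolyX R (mnm1 k)) (mesh N) ks
    (fun y => mpolyC n (g y)) 0) = walk (x 0) (mesh N) ks g 0.
Proof.
rewrite rmorph_walk; congr (walk _ _ _ _ _); apply/funext => k /=.
  exact: mevalXU.
exact: mevalC.
Qed.

Lemma meval_bernstein N f x :
  meval (x 0) (bernstein N f) = walk (x 0) (mesh N) (sweeps N.+1) f 0.
Proof. exact: meval_walkX. Qed.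

Lemma meval_mderiv_bernstein N f k x :
  meval (x 0) (mderiv k (bernstein N f)) =
  walk (x 0) (mesh N) (rem k (sweeps N.+1))
    (fun y => N.+1%:R * (f (y + mesh N k) - f y)) 0.
Proof.
have DX l : mderiv k (mpolyX R (mnm1 l)) = (l == k)%:R :> mpoly n R.
  rewrite mderivX mnm1E; case: (eqVneq l k) => [->|_]; last by rewrite scale0r.
  have -> : mnm_sub (mnm1 k) (mnm1 k) = mnm0.
    by apply/mnmP => i; rewrite mnmBE mnm0E subnn.
  by rewrite scale1r mpolyX0.
rewrite (@derivation_walk _ _ _ _ _ _ _ _ _ k (mderivM k) DX); last first.
  by move=> z; exact: mderivC.
rewrite count_sweeps rmorphM rmorph_nat.
rewrite (_ : (fun z => mpolyC n (f (z + mesh N k)) - mpolyC n (f z)) =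
  (fun z => mpolyC n (f (z + mesh N k) - f z))); last first.
  by apply/funext => z; rewrite mpolyCB.
rewrite [X in _ * X](meval_walkX N _ (fun z => f (z + mesh N k) - f z) x).
have := walk_comb (x 0) (mesh N) (rem k (sweeps N.+1)) N.+1%:R
  (fun y => f (y + mesh N k) - f y) (fun=> 0) 0.
rewrite walk_cst addr0 => <-; congr (walk _ _ _ _ _).
by apply/funext => y; rewrite addr0.
Qed.

Lemma norm_walk_le N ks g (b : 'rV[R]_n -> R) x :
  cube x ->
  (forall z, (forall l, 0 <= z 0 l <= N.+1%:R^-1 * (count_mem l ks)%:R) ->
     `|g z| <= b z) ->
  `|walk (x 0) (mesh N) ks g 0| <= walk (x 0) (mesh N) ks b 0.
Proof.
move=> cx gb; have h0 : 0 <= N.+1%:R^-1 :> R by rewrite invr_ge0.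
have gN : walk (x 0) (mesh N) ks (fun y => -1 * g y + 0) 0 =
    - walk (x 0) (mesh N) ks g 0.
  by rewrite walk_comb walk_cst addr0 mulN1r.
rewrite ler_norml lerNl -gN; apply/andP; split; apply: ler_walk => // z Hz.
  rewrite mulN1r addr0; apply: le_trans (ler_norm _) _; rewrite normrN.
  by apply: gb => l; have := Hz l; rewrite mxE add0r.
apply: le_trans (ler_norm _) _.
by apply: gb => l; have := Hz l; rewrite mxE add0r.
Qed.

Lemma walk_sum (T : finType) N ks (g : T -> 'rV[R]_n -> R) x y :
  walk (x 0) (mesh N) ks (fun z => \sum_i g i z) y =
  \sum_i walk (x 0) (mesh N) ks (g i) y.
Proof.
elim: ks y => [//|k ks IH] y /=; rewrite !IH !mulr_sumr -big_split.
by [].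
Qed.

(** The range of step counts covers both the polynomial, with N + 1 steps in each direction, and its
    k-th derivative, which has lost one step in direction k. *)
Lemma walk_dist_le N ks g (c e C : R) x :
  cube x -> 0 <= C -> (forall l, (N <= count_mem l ks <= N.+1)%N) ->
  (forall z, (forall l, 0 <= z 0 l <= N.+1%:R^-1 * (count_mem l ks)%:R) ->
     `|g z - c| <= e + C * \sum_l (z 0 l - x 0 l) ^+ 2) ->
  `|walk (x 0) (mesh N) ks g 0 - c| <= e + C * n%:R * 2 / N.+1%:R.
Proof.
move=> cx C0 Nks gc.
have -> : walk (x 0) (mesh N) ks g 0 - c =
    walk (x 0) (mesh N) ks (fun z => g z - c) 0.
  rewrite -[in LHS](walk_cst (x 0) (mesh N) ks c 0) addrC -mulN1r -walk_comb.
  by congr (walk _ _ _ _ _); apply/funext => z; ring.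
apply: le_trans (norm_walk_le cx gc) _.
have -> : (fun z => e + C * \sum_l (z 0 l - x 0 l) ^+ 2) =
    (fun z => C * (\sum_l (z 0 l - x 0 l) ^+ 2) + e).
  by apply/funext => z; rewrite addrC.
rewrite walk_comb walk_cst addrC lerD2l -!mulrA ler_wpM2l // walk_sum.
rewrite mulr_natl -[X in _ *+ X]card_ord -sumr_const ler_sum // => l _.
rewrite walk_sqr mxE add0r.
set h : R := N.+1%:R^-1.
have /andP[x0 x1] := cx l.
have h0 : 0 <= h by rewrite invr_ge0.
have hN : h * N.+1%:R = 1 by rewrite mulVf.
have h1 : h <= 1 by rewrite invf_le1 // ler1n.
have /andP[ca cb] := Nks l.
have q1 : h * (count_mem l ks)%:R <= 1 by rewrite -[leRHS]hN ler_wpM2l ?ler_nat.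
have q0 : 1 - h <= h * (count_mem l ks)%:R.
  rewrite -[X in X - _]hN -{2}[h]mulr1 -mulrBr ler_wpM2l //.
  by rewrite -natr1 addrK ler_nat.
rewrite expr2 -[h * h * _]mulrA.
(* With q between 1 - h and 1, the squared bias and the variance are each at most h. This is the
   origin of the factor 2 / (N + 1) for each of the n coordinates. *)
move: (h * _) q0 q1 => q q0 q1.
rewrite (_ : _ + _ =
  ((1 - q) * x 0 l) ^+ 2 + h * (q * (x 0 l * (1 - x 0 l)))); last by ring.
have qx : 0 <= (1 - q) * x 0 l <= h.
  rewrite mulr_ge0 ?subr_ge0 //=; apply: (@le_trans _ _ (1 - q)); last by lra.
  by rewrite ler_piMr // subr_ge0.
have q'0 : 0 <= q by lra.
have qxx : 0 <= q * (x 0 l * (1 - x 0 l)) <= 1.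
  rewrite !mulr_ge0 ?subr_ge0 //=; apply: mulr_ile1 => //.
    by rewrite mulr_ge0 ?subr_ge0.
  by apply: mulr_ile1 => //; lra.
move: ((1 - q) * _) (q * _) qx qxx => u v uh vh.
have U : u * u <= h * 1 by apply: ler_pM; lra.
have W : h * v <= h * 1 by apply: ler_wpM2l; lra.
by rewrite expr2; lra.
Qed.

(** [K] may depend on [e], as the constant of [closed_cube_majorant] does. *)
Lemma cvg_of_dist_le (a : nat -> R) (l : R) :
  (forall e, 0 < e -> exists K, forall N, `|a N - l| <= e + K / N.+1%:R) ->
  a N @[N --> \oo] --> l.
Proof.
move=> H; apply/cvgrPdist_le => e e0.
have e2 : 0 < e / 2 by rewrite divr_gt0.
have [K aK] := H _ e2.
have : K * harmonic N @[N --> \oo] --> K * 0.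
  by apply: cvgM; [exact: cvg_cst|exact: cvg_harmonic].
rewrite mulr0 => /cvgrPdist_le/(_ _ e2); apply: filterS => N.
rewrite sub0r normrN distrC => KN; apply: le_trans (aK N) _.
by rewrite [leRHS]splitr lerD2l (le_trans (ler_norm _)).
Qed.

Lemma reach_cube N ks z :
  (forall l, (count_mem l ks <= N.+1)%N) ->
  (forall l, 0 <= z 0 l <= N.+1%:R^-1 * (count_mem l ks)%:R) -> cube z.
Proof.
move=> Nks Hz l; have /andP[-> /le_trans -> //] := Hz l.
by rewrite mulrC ler_pdivrMr // mul1r ler_nat.
Qed.

Lemma count_rem_sweeps N k l :
  count_mem l (rem k (sweeps N.+1)) = (N.+1 - (l == k))%N.
Proof.
have /seq.permP/(_ (pred1 l)) : perm_eq (sweeps N.+1) (k :: rem k (sweeps N.+1)).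
  by apply: perm_to_rem; rewrite -has_pred1 has_count count_sweeps.
by move: (rem _ _) => s; rewrite count_sweeps /= eq_sym => ->; rewrite addKn.
Qed.

(** The missing step in direction k bounds the k-th coordinate of z by N / (N + 1), so one more step
    stays in the cube and the mean value theorem applies. *)
Lemma bernstein_difference N f Df k z :
    C1_scalar f Df ->
    (forall l, 0 <= z 0 l <=
       N.+1%:R^-1 * (count_mem l (rem k (sweeps N.+1)))%:R) ->
  exists y, [/\ cube y, forall l, `|y 0 l - z 0 l| <= N.+1%:R^-1 &
    N.+1%:R * (f (z + mesh N k) - f z) = Df k y].
Proof.
move=> fC Hz; have cz : cube z.
  by apply: reach_cube Hz => l; rewrite count_rem_sweeps leq_subr.
have zk : z 0 k + N.+1%:R^-1 <= 1.
  have /andP[_ zk] := Hz k; apply: le_trans (lerD zk (lexx _)) _.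
  rewrite count_rem_sweeps eqxx subn1 /= -{2}[N.+1%:R^-1]mulr1 -mulrDr natr1.
  by rewrite mulVf.
have [|y [cy yz E]] := closed_cube_MVT fC _ cz zk; first by rewrite invr_gt0.
by exists y; split => //; rewrite E mulrA divff ?mul1r.
Qed.

Lemma bernstein_bounded f Df : C1_scalar f Df ->
  exists M, forall N x, cube x -> `|meval (x 0) (bernstein N f)| <= M.
Proof.
move=> [/closed_cube_bounded[M M0 fM] _ _]; exists M => N x cx.
rewrite meval_bernstein; apply: (@le_trans _ _
    (walk (x 0) (mesh N) (sweeps N.+1) (fun=> M) 0)); last by rewrite walk_cst.
apply: norm_walk_le => // z Hz; apply: fM; apply: reach_cube Hz => l.
by rewrite count_sweeps.
Qed.

Lemma mderiv_bernstein_bounded f Df k : C1_scalar f Df ->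
  exists M, forall N x, cube x -> `|meval (x 0) (mderiv k (bernstein N f))| <= M.
Proof.
move=> fC; have [_ /(_ k)/closed_cube_bounded[M M0 fM] _] := fC.
exists M => N x cx; rewrite meval_mderiv_bernstein; apply: (@le_trans _ _
    (walk (x 0) (mesh N) (rem k (sweeps N.+1)) (fun=> M) 0));
  last by rewrite walk_cst.
apply: norm_walk_le => // z Hz.
by have [y [cy _ ->]] := bernstein_difference fC Hz; exact: fM.
Qed.

Lemma bernstein_cvg f Df x : C1_scalar f Df -> cube x ->
  meval (x 0) (bernstein N f) @[N --> \oo] --> f x.
Proof.
move=> [cf _ _] cx; apply: cvg_of_dist_le => e e0.
have [C C0 fC] := closed_cube_majorant cf cx e0.
exists (C * n%:R * 2) => N; rewrite meval_bernstein.
apply: walk_dist_le => // [l|z Hz]; first by rewrite count_sweeps leqnSn leqnn.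
by apply: fC; apply: reach_cube Hz => l; rewrite count_sweeps.
Qed.

Lemma mderiv_bernstein_cvg f Df k x : C1_scalar f Df -> cube x ->
  meval (x 0) (mderiv k (bernstein N f)) @[N --> \oo] --> Df k x.
Proof.
move=> fC cx; have [_ /(_ k) cDf _] := fC; apply: cvg_of_dist_le => e e0.
have [C C0 DC] := closed_cube_majorant cDf cx e0.
(* The majorant is taken at the mean value point y, the walk ends at z. From (y - x)^2 <= 2 (y -
   z)^2 + 2 (z - x)^2 in each coordinate, the first summand accounts for the displacement from z to
   y, the second for the walk, with [C] doubled. *)
exists (2 * C * n%:R + 2 * C * n%:R * 2) => N; rewrite meval_mderiv_bernstein.
set h : R := N.+1%:R^-1.
have h0 : 0 <= h by rewrite invr_ge0.
have h1 : h <= 1 by rewrite invf_le1 // ler1n.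
apply: (@le_trans _ _ ((e + 2 * C * n%:R * h) + 2 * C * n%:R * 2 / N.+1%:R)).
  apply: walk_dist_le => // [|l|z Hz]; first by rewrite mulr_ge0.
    by rewrite count_rem_sweeps; case: (l == k);
      rewrite ?subn1 ?subn0 /= leqnn leqnSn.
  have [y [cy yz ->]] := bernstein_difference fC Hz.
  apply: le_trans (DC _ cy) _; rewrite -addrA lerD2l.
  rewrite (_ : 2 * C * n%:R * h = C * (2 * h *+ n));
    last by rewrite -mulr_natr; ring.
  rewrite (mulrC 2 C) -(mulrA C) -mulrDr ler_wpM2l //.
  rewrite -[X in _ *+ X]card_ord -sumr_const mulr_sumr -big_split ler_sum //= => l _.
  have ah : (y 0 l - z 0 l) ^+ 2 <= h.
    rewrite -[_ ^+ 2]real_normK ?num_real // expr2 -[leRHS]mulr1.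
    by apply: ler_pM => //; exact: le_trans (yz l) _.
  have := sqr_ge0 ((y 0 l - z 0 l) - (z 0 l - x 0 l)).
  by move: (y 0 l) (z 0 l) (x 0 l) ah => u v w; lra.
by rewrite mulrDl -/h; lra.
Qed.
End bernstein.

(** * Integration over cubes *)

Section cube_integrals.
Context (R : realType).
Local Notation TR := (measurableTypeR R).
Local Notation mu := (lebesgue_tuple R).

Lemma measurable_unit_cube n : measurable (unit_cube R n).
Proof.
rewrite [X in measurable X](_ : _ = \big[setI/setT]_(i <- index_enum 'I_n)
    ((fun t : n.-tuple TR => tnth t i) @^-1` `]0, 1[%classic)).
  apply: bigsetI_measurable => i _.
  by rewrite -[X in measurable X]setTI; apply: measurable_tnth.
apply/seteqP; split => t /=; rewrite -bigcap_seq => t01 i; have := t01 i.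
  by rewrite /= in_itv /=.
by rewrite /= mem_index_enum in_itv /=; apply.
Qed.

Lemma measure_unit_cube n : mu n (unit_cube R n) = 1%E.
Proof.
have -> : unit_cube R n = [set t | forall i, `]0, 1[%classic (tnth t i)].
  by apply/seteqP; split => t /= + i => /(_ i); rewrite in_itv.
rewrite (@lebesgue_tuple_box R n (fun=> `]0, 1[%classic)) // big1 // => i _.
by rewrite lebesgue_measure_itv /= lte_fin ltr01 sube0.
Qed.

Lemma integral_exprn_01 (e : nat) :
  (\int[lebesgue_measure]_(x in `]0%R, 1%R[) (x ^+ e)%:E = (e.+1%:R^-1 : R)%:E)%E.
Proof.
rewrite -(@integral_itv_bndoo _ _ _ _ true false); last first.
  by apply/measurable_EFinP/measurable_funX; exact: measurable_id.
rewrite (@continuous_FTC2 _ _ (fun x => x ^+ e.+1 / e.+1%:R)) //=.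
- by rewrite expr1n expr0n /= mul0r sube0 mul1r.
- by apply: continuous_in_subspaceT => x _; exact: exprn_continuous.
- split.
  + by move=> x _; apply: derivableM => //; exact: exprn_derivable.
  + apply: cvg_at_right_filter; apply: cvgM; last exact: cvg_cst.
    exact: exprn_continuous.
  + apply: cvg_at_left_filter; apply: cvgM; last exact: cvg_cst.
    exact: exprn_continuous.
- move=> x _; rewrite derive1Mr; last exact: exprn_derivable.
  rewrite derive1E exp_derive /= scaler1 -mulr_natr mulrAC divff ?mul1r //.
Qed.

Lemma measurable_monomial n (e : 'I_n -> nat) D :
  measurable_fun D (fun t : n.-tuple TR => \prod_k tnth t k ^+ e k).
Proof.
apply: measurable_funTS; apply: measurable_prod => k _.
by apply: measurable_funX; exact: measurable_tnth.
Qed.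

Lemma integral_monomial n (e : 'I_n -> nat) :
  (\int[mu n]_(t in unit_cube R n) (\prod_k tnth t k ^+ e k)%:E =
   (\prod_k (e k).+1%:R^-1)%:E)%E.
Proof.
elim: n e => [|n IH] e.
  rewrite /= integral_dirac; [|exact: measurable_unit_cube|].
    by rewrite diracE mem_set ?big_ord0 ?mul1e // => -[].
  by apply/measurable_EFinP; exact: measurable_monomial.
have g0 m (u : 'I_m -> nat) t : unit_cube R m t ->
    (0 <= (\prod_k tnth t k ^+ u k)%:E)%E.
  move=> t01; rewrite lee_fin; apply: prodr_ge0 => k _; apply: exprn_ge0.
  by have /andP[/ltW] := t01 k.
rewrite [LHS](@ge0_integral_pushforward _ _ _ _ _ _ (@measurable_cons_pair R n)
  (@lebesgue_measure R \x mu n)%E); first last.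
- by move=> t; rewrite inE; exact: g0.
- by apply/measurable_EFinP; exact: measurable_monomial.
- exact: measurable_unit_cube.
(* Extension by zero off the cube makes the integrand a product of a function of the head and a
   function of the tail, ready for Tonelli. *)
pose a (x : R) : \bar R := ((fun x : R => (x ^+ e ord0)%:E) \_ `]0%R, 1%R[) x.
pose b := (fun t => (\prod_k tnth t k ^+ e (lift ord0 k))%:E) \_ (unit_cube R n).
have ma : measurable_fun setT a.
  apply/(measurable_restrictT _ _).1 => //.
  by apply/measurable_EFinP/measurable_funX.
have mb : measurable_fun setT b.
  apply/(measurable_restrictT _ _).1; first exact: measurable_unit_cube.
  by apply/measurable_EFinP; exact: measurable_monomial.
have a0 x : (0 <= a x)%E.
  rewrite /a patchE; case: ifPn => //; rewrite inE /= in_itv /= => /andP[/ltW x0 _].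
  by rewrite lee_fin exprn_ge0.
have b0 t : (0 <= b t)%E.
  by rewrite /b patchE; case: ifPn => //; rewrite inE; exact: g0.
rewrite integral_mkcond (_ : _ \_ _ = (fun p => a p.1 * b p.2)%E); last first.
  apply/funext => -[x t]; rewrite /a /b !patchE /=.
  have -> : ((x, t) \in @cons_pair R n @^-1` unit_cube R n.+1) =
      (x \in `]0%R, 1%R[%classic) && (t \in unit_cube R n).
    apply/idP/andP; rewrite !inE /= in_itv /=.
      by move=> xt; split=> [|k]; [exact: (xt ord0)|
        have := xt (lift ord0 k); rewrite tnthS].
    by move=> [x01 t01] i; have [k ->|->//] := unliftP ord0 i; rewrite tnthS.
  case: (x \in _); case: (t \in _); rewrite /= ?mul0e ?mule0 //.
  rewrite big_ord_recl EFinM; congr (_ * (_)%:E)%E.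
  by apply: eq_bigr => k _; rewrite tnthS.
rewrite fubini_tonelli1; first last.
- by move=> p; rewrite mule_ge0.
- apply: emeasurable_funM; first exact: measurableT_comp ma measurable_fst.
  exact: measurableT_comp mb measurable_snd.
transitivity (\int[lebesgue_measure]_x
    (a x * (\prod_(k < n) (e (lift ord0 k)).+1%:R^-1)%:E))%E.
  apply: eq_integral => x _; rewrite /fubini_F /= ge0_integralZl //.
  by rewrite /b -integral_mkcond IH.
rewrite ge0_integralZr //; last first.
  by rewrite lee_fin; apply: prodr_ge0 => k _; rewrite invr_ge0.
by rewrite /a -integral_mkcond integral_exprn_01 big_ord_recl EFinM.
Qed.

Lemma measurable_meval d (T : measurableType d) D m (v : T -> 'I_m -> R)
    (p : mpoly m R) :
    (forall j, measurable_fun D (v ^~ j)) ->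
  measurable_fun D (fun t => meval (v t) p).
Proof.
move=> mv; under eq_fun do rewrite mevalE.
apply: measurable_sum => u; apply: measurable_funM => //.
by apply: measurable_prod => k _; exact: measurable_funX.
Qed.

Lemma meval_bounded m (p : mpoly m R) :
  exists M, forall v : 'I_m -> R, (forall j, `|v j| <= 1) -> `|meval v p| <= M.
Proof.
exists (\sum_(u <- msupp p) `|mcoeff u p|) => v v1; rewrite mevalE.
apply: le_trans (ler_norm_sum _ _ _) _; apply: ler_sum => u _.
rewrite normrM ler_piMr // normr_prod.
by apply: prodr_ile1 => k _; rewrite normr_ge0 normrX exprn_ile1.
Qed.

Lemma integrable_meval n m (v : n.-tuple TR -> 'I_m -> R) (p : mpoly m R) :
    (forall j, measurable_fun setT (v ^~ j)) ->
    (forall t j, unit_cube R n t -> `|v t j| <= 1) ->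
  (mu n).-integrable (unit_cube R n) (EFin \o (fun t => meval (v t) p)).
Proof.
move=> mv v1; apply: measurable_bounded_integrable.
- exact: measurable_unit_cube.
- by rewrite [X in (X < _)%E]measure_unit_cube ltry.
- by apply: measurable_funTS; exact: measurable_meval.
have [M pM] := meval_bounded p.
exists M; split=> [|K MK t /= Dt]; first exact: num_real.
by apply: le_trans (ltW MK); apply: pM => j; exact: v1.
Qed.

(** Constants are integrable because the cube has measure 1. Measurability of the limit on the cube
    is inherited from the approximants. *)
Lemma bounded_cvg_Rintegral n (f_ : nat -> n.-tuple TR -> R) f (M : R) :
    (forall N, measurable_fun setT (f_ N)) ->
    (forall N t, unit_cube R n t -> `|f_ N t| <= M) ->
    (forall t, unit_cube R n t -> f_ N t @[N --> \oo] --> f t) ->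
  (mu n).-integrable (unit_cube R n) (EFin \o f) /\
  \int[mu n]_(t in unit_cube R n) f_ N t @[N --> \oo] -->
  \int[mu n]_(t in unit_cube R n) f t.
Proof.
move=> mf fM ff; have mD := @measurable_unit_cube n.
have mf' N : measurable_fun (unit_cube R n) (EFin \o f_ N).
  by apply/measurable_EFinP; exact: measurable_funTS.
have ff' t : unit_cube R n t -> (EFin \o f_ N) t @[N --> \oo] --> (EFin \o f) t.
  by move=> Dt; apply: cvg_EFin; [exact: nearW|exact: ff].
have [] := @dominated_convergence _ _ _ (mu n) _ mD (fun N => EFin \o f_ N)
  (EFin \o f) (cst M%:E) mf'.
- exact: emeasurable_fun_cvg mf' ff'.
- exact: aeW.
- apply: measurable_bounded_integrable => //.
    by rewrite [X in (X < _)%E]measure_unit_cube ltry.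
  by exists `|M|; split=> [|K /ltW MK t _ /=]; first exact: num_real.
- by apply: aeW => t N Dt; rewrite lee_fin; exact: fM.
move=> intf _ cf; split=> //; apply: fine_cvg; move: cf.
by rewrite fineK // integrable_fin_num.
Qed.

Lemma Rintegral_sum n (I : Type) (r : seq I) (f : I -> n.-tuple TR -> R) :
    (forall a, (mu n).-integrable (unit_cube R n) (EFin \o f a)) ->
  (mu n).-integrable (unit_cube R n) (EFin \o (fun t => \sum_(a <- r) f a t)) /\
  \int[mu n]_(t in unit_cube R n) (\sum_(a <- r) f a t) =
  \sum_(a <- r) \int[mu n]_(t in unit_cube R n) f a t.
Proof.
move=> intf; have mD := @measurable_unit_cube n.
elim: r => [|a r [intr IH]].
  split; first by under eq_fun do rewrite big_nil; exact: integrable0.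
  rewrite big_nil; under eq_Rintegral do rewrite big_nil.
  by rewrite Rintegral_cst // mul0r.
split.
  have := integrableD mD (intf a) intr; apply: eq_integrable => // t _.
  by rewrite /= big_cons EFinD.
under eq_Rintegral do rewrite big_cons.
by rewrite RintegralD // IH big_cons.
Qed.
End cube_integrals.

(** * Stokes' identity for polynomial maps *)

Section polynomial_stokes.
Context (R : realType).
Local Notation TR := (measurableTypeR R).
Local Notation mu := (lebesgue_tuple R).

Lemma row_tupleE n (t : n.-tuple TR) k : row_tuple t 0 k = tnth t k.
Proof. by rewrite mxE. Qed.

Lemma face_point_lift n (i : 'I_n.+1) s (t : n.-tuple TR) k :
  @face_point R n.+1 i s t 0 (lift i k) = tnth t k.
Proof. by rewrite mxE liftK. Qed.

Lemma face_pointE n (i : 'I_n.+1) s (t : n.-tuple TR) :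
  @face_point R n.+1 i s t 0 i = s%:R.
Proof. by rewrite mxE unlift_none. Qed.

Lemma row_tuple_closed_cube n (t : n.-tuple TR) :
  unit_cube R n t -> closed_cube R n (row_tuple t).
Proof. by move=> t01 k; rewrite row_tupleE; have := t01 k; lra. Qed.

Lemma face_point_open_face n (i : 'I_n.+1) s (t : n.-tuple TR) :
  unit_cube R n t -> open_face i s (@face_point R n.+1 i s t).
Proof.
move=> t01; split=> [|k]; first exact: face_pointE.
by have [j ->|->] := unliftP i k; rewrite ?eqxx // face_point_lift => _; exact: t01.
Qed.

Lemma open_face_closed_cube n (i : 'I_n) s z :
  open_face i s z -> closed_cube R n z.
Proof.
move=> [zi zk] k; have [->|/zk] := eqVneq k i; last lra.
by rewrite zi; case: s zi; rewrite ?lexx ?ler01.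
Qed.

Lemma closed_cube_norm n (x : 'rV[R]_n) j : closed_cube R n x -> `|x 0 j| <= 1.
Proof. by move=> /(_ j) /andP[x0 x1]; rewrite ger0_norm. Qed.

Lemma measurable_row_tuple n j :
  measurable_fun setT (fun t : n.-tuple TR => row_tuple t 0 j).
Proof. by under eq_fun do rewrite row_tupleE; exact: measurable_tnth. Qed.

Lemma measurable_face_point n (i j : 'I_n.+1) s :
  measurable_fun setT (fun t : n.-tuple TR => @face_point R n.+1 i s t 0 j).
Proof.
have [k ->|->] := unliftP i j.
  by under eq_fun do rewrite face_point_lift; exact: measurable_tnth.
by under eq_fun do rewrite face_pointE; exact: measurable_cst.
Qed.

Lemma Rintegral_monomial n (e : 'I_n -> nat) :
  \int[mu n]_(t in unit_cube R n) (\prod_k tnth t k ^+ e k) =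
  \prod_k (e k).+1%:R^-1.
Proof. by rewrite /Rintegral integral_monomial. Qed.

Lemma integrable_monomial n (e : 'I_n -> nat) :
  (mu n).-integrable (unit_cube R n) (EFin \o (fun t => \prod_k tnth t k ^+ e k)).
Proof.
apply: measurable_bounded_integrable.
- exact: measurable_unit_cube.
- by rewrite [X in (X < _)%E]measure_unit_cube ltry.
- exact: measurable_monomial.
exists 1; split=> [|K /ltW K1 t /= t01]; first exact: num_real.
apply: le_trans K1; rewrite normr_prod; apply: prodr_ile1 => k _.
have /andP[/ltW t0 /ltW t1] := t01 k.
by rewrite normr_ge0 normrX exprn_ile1 // ger0_norm.
Qed.

Lemma Rintegral_meval_comb n m (v : n.-tuple TR -> 'I_m -> R) c p q :
    (forall j, measurable_fun setT (v ^~ j)) ->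
    (forall t j, unit_cube R n t -> `|v t j| <= 1) ->
  \int[mu n]_(t in unit_cube R n) meval (v t) (c *: p + q) =
  c * \int[mu n]_(t in unit_cube R n) meval (v t) p +
  \int[mu n]_(t in unit_cube R n) meval (v t) q.
Proof.
move=> mv v1; have mD := @measurable_unit_cube R n.
under eq_Rintegral do rewrite mevalD mevalZ.
rewrite RintegralD //; first by rewrite RintegralZl //; exact: integrable_meval.
  have := @integrable_meval R n m v (c *: p) mv v1.
  by apply: eq_integrable => // t _; rewrite /= mevalZ.
exact: integrable_meval.
Qed.

Lemma Rintegral_meval0 n m (v : n.-tuple TR -> 'I_m -> R) :
    (forall j, measurable_fun setT (v ^~ j)) ->
    (forall t j, unit_cube R n t -> `|v t j| <= 1) ->
  \int[mu n]_(t in unit_cube R n) meval (v t) 0 = 0.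
Proof.
move=> mv v1; have := Rintegral_meval_comb (-1) 0 0 mv v1.
by rewrite scaler0 addr0 mulN1r addNr.
Qed.

Lemma Rintegral_mderiv n (i : 'I_n.+1) (p : mpoly n.+1 R) :
  \int[mu n.+1]_(t in unit_cube R n.+1) meval (row_tuple t 0) (mderiv i p) =
  \int[mu n]_(t in unit_cube R n) meval (face_point i true t 0) p -
  \int[mu n]_(t in unit_cube R n) meval (face_point i false t 0) p.
Proof.
have mr j := @measurable_row_tuple n.+1 j.
have r1 t j : unit_cube R n.+1 t -> `|row_tuple t 0 j| <= 1.
  by move=> /row_tuple_closed_cube /closed_cube_norm.
have mf s j := @measurable_face_point n i j s.
have f1 s t j : unit_cube R n t -> `|@face_point R n.+1 i s t 0 j| <= 1.
  by move=> /(face_point_open_face i s)/open_face_closed_cube /closed_cube_norm.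
elim/mpolyind: p => [|c u p _ _ IH].
  by rewrite raddf0 (Rintegral_meval0 mr r1) !(Rintegral_meval0 (mf _) (f1 _)) subr0.
rewrite mderivD mderivZ (Rintegral_meval_comb _ _ _ mr r1).
rewrite !(Rintegral_meval_comb _ _ _ (mf _) (f1 _)) IH.
suff -> : \int[mu n.+1]_(t in unit_cube R n.+1)
      meval (row_tuple t 0) (mderiv i (mpolyX R u)) =
    \int[mu n]_(t in unit_cube R n) meval (face_point i true t 0) (mpolyX R u) -
    \int[mu n]_(t in unit_cube R n) meval (face_point i false t 0) (mpolyX R u).
  by ring.
have E s : \int[mu n]_(t in unit_cube R n)
      meval (@face_point R n.+1 i s t 0) (mpolyX R u) =
    s%:R ^+ u i * \prod_k (u (lift i k)).+1%:R^-1.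
  rewrite -Rintegral_monomial -RintegralZl.
  - apply: eq_Rintegral => t _; rewrite mevalX (bigD1_ord i) //= face_pointE.
    by congr (_ * _); apply: eq_bigr => k _; rewrite face_point_lift.
  - exact: measurable_unit_cube.
  exact: integrable_monomial.
rewrite !E -mulrBl expr1n.
rewrite mderivX.
have := Rintegral_meval_comb (u i)%:R (mpolyX R (mnm_sub u (mnm1 i))) 0 mr r1.
rewrite addr0 => ->; rewrite (Rintegral_meval0 mr r1) addr0.
under eq_Rintegral => t _.
  rewrite mevalX; under eq_bigr do rewrite row_tupleE. over.
rewrite Rintegral_monomial (bigD1_ord i) //= mulrA mnmBE mnm1E eqxx.
congr (_ * _).
  (* For exponent 0 the truncated subtraction is harmless, its coefficient being 0; on the other
     side 0 ^ 0 = 1 makes the two faces cancel. *)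
  case: (u i) => [|e]; first by rewrite mul0r expr0 subrr.
  by rewrite subn1 /= divff ?pnatr_eq0 // expr0n subr0.
by apply: eq_bigr => k _; rewrite mnmBE mnm1E (negPf (neq_lift _ _)) subn0.
Qed.

Lemma polynomial_stokes n (P : 'I_n.+1 -> mpoly n.+1 R) a :
  let M (x : 'rV[R]_n.+1) : 'M[R]_n.+1 :=
    \matrix_(k, b) meval (x 0) (mderiv k (P b)) in
  let flux (i : 'I_n.+1) s := \int[mu n]_(t in unit_cube R n)
    (meval (face_point i s t 0) (P a) * cofactor (M (face_point i s t)) i a) in
  \int[mu n.+1]_(t in unit_cube R n.+1) \det (M (row_tuple t)) =
  \sum_i (flux i true - flux i false).
Proof.
move=> M flux; pose MP : 'M[mpoly n.+1 R]_n.+1 := \matrix_(k, b) mderiv k (P b).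
have ME x : M x = map_mx (meval (x 0)) MP by apply/matrixP => k b; rewrite !mxE.
pose d (i : 'I_n.+1) : {additive mpoly n.+1 R -> mpoly n.+1 R} := mderiv i.
have fluxE i s : flux i s = \int[mu n]_(t in unit_cube R n)
    meval (face_point i s t 0) (P a * cofactor MP i a).
  by apply: eq_Rintegral => t _; rewrite ME cofactor_map_mx [RHS]mevalM.
under eq_Rintegral do rewrite ME det_map_mx.
rewrite [\det MP](@det_divergence _ _ d P a); first last.
- by move=> i j p; exact: mderiv_comm.
- by move=> i p q; exact: mderivM.
under [RHS]eq_bigr do rewrite !fluxE -Rintegral_mderiv.
rewrite -/MP; move: (index_enum _) => r.
elim: r => [|i r IH].
  rewrite big_nil; under eq_Rintegral do rewrite big_nil.
  apply: Rintegral_meval0 => [j|t j]; first exact: measurable_row_tuple.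
  by move=> /row_tuple_closed_cube /closed_cube_norm.
rewrite [RHS]big_cons -IH.
have := @Rintegral_meval_comb n.+1 n.+1 (fun t => row_tuple t 0) 1
  (d i (P a * cofactor MP i a)) (\sum_(i <- r) d i (P a * cofactor MP i a)).
rewrite mul1r scale1r => <-.
- by apply: eq_Rintegral => t _; rewrite big_cons.
- by move=> j; exact: measurable_row_tuple.
by move=> t j /row_tuple_closed_cube /closed_cube_norm.
Qed.
End polynomial_stokes.

(** * Stokes' identity *)

Section stokes.
Context (R : realType).
Local Notation TR := (measurableTypeR R).
Local Notation mu := (lebesgue_tuple R).

Lemma cvg_det n (A : nat -> 'M[R]_n) (B : 'M[R]_n) :
    (forall i j, A N i j @[N --> \oo] --> B i j) ->
  \det (A N) @[N --> \oo] --> \det B.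
Proof.
move=> AB; apply: (@cvg_big _ _ (fun x y : R => x + y)) => [|s _].
  exact: add_continuous.
apply: cvgM; first exact: cvg_cst.
apply: (@cvg_big _ _ (fun x y : R => x * y)) => [|i _]; last exact: AB.
exact: mul_continuous.
Qed.

Lemma det_bounded n (C : R) :
  exists M, forall A : 'M[R]_n, (forall i j, `|A i j| <= C) -> `|\det A| <= M.
Proof.
exists (\sum_(s : 'S_n) C ^+ n) => A AC.
apply: le_trans (ler_norm_sum _ _ _) _; apply: ler_sum => s _.
rewrite normrM normrX normrN1 expr1n mul1r normr_prod.
rewrite -[X in _ ^+ X]card_ord -prodr_const.
by apply: ler_prod => i _; rewrite normr_ge0 AC.
Qed.

Lemma cvg_cofactor n (A : nat -> 'M[R]_n) (B : 'M[R]_n) i a :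
    (forall i j, A N i j @[N --> \oo] --> B i j) ->
  cofactor (A N) i a @[N --> \oo] --> cofactor B i a.
Proof.
move=> AB; rewrite cofactor_det; under eq_fun do rewrite cofactor_det.
apply: cvg_det => k b; rewrite mxE; under eq_fun do rewrite mxE.
by case: (k == i); [exact: cvg_cst|exact: AB].
Qed.

Lemma measurable_det d (T : measurableType d) D n (A : T -> 'M[R]_n) :
    (forall i j, measurable_fun D (fun t => A t i j)) ->
  measurable_fun D (fun t => \det (A t)).
Proof.
move=> mA; apply: measurable_sum => s; apply: measurable_funM => //.
by apply: measurable_prod => i _; exact: mA.
Qed.

Lemma measurable_cofactor d (T : measurableType d) D n (A : T -> 'M[R]_n) i a :
    (forall i j, measurable_fun D (fun t => A t i j)) ->
  measurable_fun D (fun t => cofactor (A t) i a).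
Proof.
move=> mA; under eq_fun do rewrite cofactor_det.
apply: measurable_det => k b; under eq_fun do rewrite mxE.
by case: (k == i); [exact: measurable_cst|exact: mA].
Qed.

Lemma cofactor_bounded n (C : R) :
  exists M, forall (A : 'M[R]_n) i a,
    (forall i j, `|A i j| <= C) -> `|cofactor A i a| <= M.
Proof.
(* The 1 accounts for the unit row that [cofactor_det] puts in place of row i. *)
have [M MC] := det_bounded n (Num.max 1 C); exists M => A i a AC.
rewrite cofactor_det; apply: MC => k b; rewrite mxE le_max.
case: (k == i); last by rewrite AC orbT.
by case: (b == a); rewrite ?normr1 ?normr0 ?lexx ?ler01.
Qed.

(** Integrability is part of the conclusion because the identities for the different [a] are added
    under the integral sign later. *)
Lemma stokes n (u : 'I_n.+1 -> 'rV[R]_n.+1 -> R)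
    (Du : 'I_n.+1 -> 'I_n.+1 -> 'rV[R]_n.+1 -> R) a :
    (forall b, C1_scalar (u b) (Du b)) ->
  let M (x : 'rV[R]_n.+1) : 'M[R]_n.+1 := \matrix_(k, b) Du b k x in
  let flux (i : 'I_n.+1) s := \int[mu n]_(t in unit_cube R n)
    (u a (face_point i s t) * cofactor (M (face_point i s t)) i a) in
  [/\ (mu n.+1).-integrable (unit_cube R n.+1)
        (EFin \o (fun t => \det (M (row_tuple t)))),
      forall i s, (mu n).-integrable (unit_cube R n) (EFin \o (fun t =>
        u a (face_point i s t) * cofactor (M (face_point i s t)) i a)) &
      \int[mu n.+1]_(t in unit_cube R n.+1) \det (M (row_tuple t)) =
      \sum_i (flux i true - flux i false)].
Proof.
move=> uC M flux; pose P N b := bernstein N (u b).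
pose MN N (x : 'rV[R]_n.+1) : 'M[R]_n.+1 :=
  \matrix_(k, b) meval (x 0) (mderiv k (P N b)).
have [M0 uM0] := choice (fun b => bernstein_bounded (uC b)).
have [M1 uM1] := choice (fun p : 'I_n.+1 * 'I_n.+1 =>
  mderiv_bernstein_bounded p.2 (uC p.1)).
pose C := \sum_p `|M1 p|.
have MNC N x : closed_cube R n.+1 x -> forall k b, `|MN N x k b| <= C.
  move=> cx k b; rewrite mxE; apply: le_trans (uM1 (b, k) N x cx) _.
  apply: le_trans (ler_norm _) _; rewrite /C (bigD1 (b, k)) //=.
  by rewrite ler_wpDr ?sumr_ge0.
have MNcvg x : closed_cube R n.+1 x ->
    forall k b, MN N x k b @[N --> \oo] --> M x k b.
  move=> cx k b; rewrite mxE; under eq_fun do rewrite mxE.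
  exact: mderiv_bernstein_cvg (uC b) cx.
have mMN N (p : nat) (v : p.-tuple TR -> 'rV[R]_n.+1) k b :
    (forall j, measurable_fun setT (fun t => v t 0 j)) ->
    measurable_fun setT (fun t => MN N (v t) k b).
  by move=> mv; under eq_fun do rewrite mxE; exact: measurable_meval.
pose fluxN N (i : 'I_n.+1) s := \int[mu n]_(t in unit_cube R n)
    (meval (face_point i s t 0) (P N a) * cofactor (MN N (face_point i s t)) i a).
have [intM lhs] : (mu n.+1).-integrable (unit_cube R n.+1)
      (EFin \o (fun t => \det (M (row_tuple t)))) /\
    \int[mu n.+1]_(t in unit_cube R n.+1) \det (MN N (row_tuple t))
    @[N --> \oo] --> \int[mu n.+1]_(t in unit_cube R n.+1) \det (M (row_tuple t)).
  have [K KC] := det_bounded n.+1 C.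
  apply: (@bounded_cvg_Rintegral _ _ _ _ K) => [N|N t Dt|t Dt].
  - apply: measurable_det => k b; apply: mMN => j; exact: measurable_row_tuple.
  - by apply: KC; apply: MNC; exact: row_tuple_closed_cube.
  by apply: cvg_det; apply: MNcvg; exact: row_tuple_closed_cube.
have fcvg i s : (mu n).-integrable (unit_cube R n) (EFin \o (fun t =>
      u a (face_point i s t) * cofactor (M (face_point i s t)) i a)) /\
    fluxN N i s @[N --> \oo] --> flux i s.
  have [K KC] := cofactor_bounded n.+1 C.
  have cf t : unit_cube R n t -> closed_cube R n.+1 (face_point i s t).
    by move=> /(face_point_open_face i s)/open_face_closed_cube.
  apply: (@bounded_cvg_Rintegral _ _ _ _ (M0 a * K)) => [N|N t Dt|t Dt].
  - apply: measurable_funM.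
      by apply: measurable_meval => j; exact: measurable_face_point.
    by apply: measurable_cofactor => k b; apply: mMN => j;
      exact: measurable_face_point.
  - rewrite normrM; apply: ler_pM => //; first by apply: uM0; exact: cf.
    by apply: KC; apply: MNC; exact: cf.
  apply: cvgM; first by apply: bernstein_cvg (uC a) _; exact: cf.
  by apply: cvg_cofactor; apply: MNcvg; exact: cf.
split=> [//|i s|]; first by have [] := fcvg i s.
apply: (cvg_unique _ lhs) => //.
rewrite (_ : (fun N => _) = fun N => \sum_i (fluxN N i true - fluxN N i false));
  last by apply/funext => N; exact: (polynomial_stokes (P N) a).
apply: (@cvg_big _ _ (fun x y : R => x + y)) => [|i _].
  exact: add_continuous.
exact: cvgB (fcvg i true).2 (fcvg i false).2.
Qed.
End stokes.

(** * From relative differentiability on the closed cube to partial derivatives and Jacobians *)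

Section C1_on_cube.
Context (R : realType).

Lemma cvg_mx T (F : set_system T) {FF : Filter F} p q (f : T -> 'M[R]_(p, q))
    (l : 'M[R]_(p, q)) :
  (forall i j, f x i j @[x --> F] --> l i j) -> f x @[x --> F] --> l.
Proof.
move=> fl; apply/cvgrPdist_le => e e0.
have : \forall x \near F, forall ij : 'I_p * 'I_q,
    `|l ij.1 ij.2 - f x ij.1 ij.2| <= e.
  apply: filter_forall => -[i j] /=.
  exact: ((cvgrPdist_le _ _).1 (fl i j)).
apply: filterS => x fx; rewrite /Num.Def.normr /= mx_normrE.
by apply: (bigmax_le _ (ltW e0)) => ij _; rewrite !mxE.
Qed.

Lemma norm_delta_mx_le n k : `|delta_mx 0 k : 'rV[R]_n| <= 1.
Proof.
rewrite /Num.Def.normr /= mx_normrE; apply: bigmax_le => // -[i j] _ /=.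
by rewrite mxE; case: (_ && _); rewrite ?normr1 ?normr0.
Qed.

Lemma mulmxr_continuous n p (A : 'M[R]_(n, p)) :
  continuous (fun x : 'rV[R]_n => x *m A).
Proof.
move=> x; apply: (@cvg_mx _ (nbhs x)) => i j; rewrite mxE; under eq_fun do rewrite mxE.
apply: (@cvg_big _ _ (fun x y : R => x + y)) => [|k _]; first exact: add_continuous.
by apply: cvgM; [exact: coord_continuous|exact: cvg_cst].
Qed.

Lemma frechet_differentiable (V W : normedModType R) (f : V -> W)
    (L : {linear V -> W}) (x : V) :
    continuous L ->
    (forall e : R, 0 < e ->
      \forall y \near x, `|f y - f x - L (y - x)| <= e * `|y - x|) ->
  differentiable f x /\ 'd f x = L :> (V -> W).
Proof.
move=> cL fx.
have E : f \o shift x = cst (f x) + L +o_ 0 id.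
  apply/eqaddoP => e e0.
  have := fx e e0; rewrite [X in X -> _](near_shift 0) subr0; apply: filterS => y /=.
  by rewrite addrK opprD addrA.
have dE := diff_unique cL E.
by split => //; apply/diff_locallyP; rewrite dE.
Qed.

Section frechet.
Context (n : nat) (phi : 'rV[R]_n -> 'rV[R]_n) (Df : 'rV[R]_n -> 'M[R]_n).
Local Notation cube := (closed_cube R n).

Definition frechet_within (x : 'rV[R]_n) := forall e : R, 0 < e ->
  \forall y \near within cube (nbhs x),
    `|phi y - phi x - (y - x) *m Df x| <= e * `|y - x|.

Lemma frechet_within_cvg (x : 'rV[R]_n) : frechet_within x ->
  phi y @[y --> within cube (nbhs x)] --> phi x.
Proof.
move=> /(_ 1 ltr01) fx; apply/cvgrPdist_le => e e0.
have g : `|y - x| + `|(y - x) *m Df x| @[y --> nbhs x] --> (0 : R).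
  have yx : (y - x) @[y --> nbhs x] --> (0 : 'rV[R]_n).
    by rewrite -(subrr x); apply: cvgB; [exact: cvg_id|exact: cvg_cst].
  rewrite -[X in _ --> X](addr0 0); apply: cvgD.
    by rewrite -(normr0 'rV[R]_n); exact: cvg_norm.
  rewrite -(normr0 'rV[R]_n) -(mul0mx _ (Df x)); apply: cvg_norm.
  exact: (@cvg_comp _ _ _ (fun y => y - x) (fun v => v *m Df x) _ _ _ yx
    (@mulmxr_continuous n n (Df x) 0)).
have {}g : \forall y \near within cube (nbhs x),
    `|y - x| + `|(y - x) *m Df x| <= e.
  have /cvgrPdist_le/(_ _ e0) := g; rewrite near_withinE; apply: filterS => y + _.
  by rewrite sub0r normrN; exact: le_trans (ler_norm _).
near=> y.
have gy : `|y - x| + `|(y - x) *m Df x| <= e by near: y.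
rewrite distrC -[phi y - phi x](subrK ((y - x) *m Df x)).
apply: le_trans (ler_normD _ _) _; apply: le_trans gy; rewrite lerD2r.
by rewrite -[leRHS]mul1r; near: y.
Unshelve. all: by end_near. Qed.

(** When the k-th coordinate is interior, x moved by a small step of either sign along direction k
    stays in the cube, even if x lies on another face. *)
Lemma frechet_within_is_derive (x : 'rV[R]_n) k : frechet_within x -> cube x ->
  0 < x 0 k < 1 -> is_derive x (delta_mx 0 k) phi (row k (Df x)).
Proof.
move=> fx cx xk.
suff H : h^-1 *: ((phi \o shift x) (h *: delta_mx 0 k) - phi x) @[h --> 0^'] -->
    row k (Df x).
  by split; [apply/cvg_ex; eexists; exact: H|exact: cvg_lim H].
apply/cvgrPdist_le => e e0.
have [d d0 /= dx] : exists2 d : R, 0 < d & forall y, `|y - x| < d -> cube y ->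
    `|phi y - phi x - (y - x) *m Df x| <= e * `|y - x|.
  have := fx _ e0; rewrite near_withinE => /nbhs_ballP[d /= d0 dx].
  exists d => // y yd; apply: dx; rewrite -ball_normE /= distrC //.
near=> h.
have h0 : h != 0 by near: h; exact: nbhs_dnbhs_neq.
have hd : `|h| < d by near: h; exact: dnbhs0_lt.
have hx0 : `|h| < x 0 k by near: h; apply: dnbhs0_lt; lra.
have hx1 : `|h| < 1 - x 0 k by near: h; apply: dnbhs0_lt; lra.
set y := h *: delta_mx 0 k + x.
have yx : y - x = h *: delta_mx 0 k by rewrite /y addrK.
have nyx : `|y - x| <= `|h|.
  by rewrite yx normrZ ler_piMr // norm_delta_mx_le.
have cy : cube y.
  move=> l; rewrite !mxE eqxx /=; have := cx l.
  case: (eqVneq l k) => [->|_]; rewrite ?mulr1 ?mulr0 ?add0r //.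
  by move: hx0 hx1; rewrite !ltr_norml; lra.
have := dx y (le_lt_trans nyx hd) cy.
rewrite yx -scalemxAl -rowE distrC -{1}(scalerKV h0 (phi y - phi x)) -scalerBr.
rewrite -yx normrZ => /le_trans/(_ (ler_wpM2l (ltW e0) nyx)).
by rewrite mulrC ler_pM2r ?normr_gt0.
Unshelve. all: by end_near. Qed.

Lemma frechet_within_differentiable (x : 'rV[R]_n) : frechet_within x ->
  (forall k, 0 < x 0 k < 1) -> differentiable phi x /\ 'J phi x = Df x.
Proof.
move=> fx x01.
have [] := @frechet_differentiable _ _ phi (mulmxr (Df x)) x.
- exact: mulmxr_continuous.
- move=> e e0; have cx : \forall y \near x, cube y.
    suff H k : \forall y \near x, 0 <= (y : 'rV[R]_n) 0 k <= 1.
      exact: filter_forall H.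
    have /andP[xk0 xk1] := x01 k.
    near=> y; apply/andP; split; apply: ltW; near: y.
      exact: (@coord_continuous R 1 n 0 k x _ (lt_nbhsr xk0)).
    exact: (@coord_continuous R 1 n 0 k x _ (lt_nbhsl xk1)).
  have := fx e e0; rewrite near_withinE => fe.
  by apply: filterS2 cx fe => y cy; apply.
move=> dphi dE; split=> //; apply/row_matrixP => k.
by rewrite /jacobian !rowE mul_rV_lin1 dE.
Unshelve. all: by end_near. Qed.
End frechet.
End C1_on_cube.

(** * Chain rule up to the boundary *)

Section composition.
Context (R : realType).

(** At boundary points [phi] has only some directional derivatives, so the chain rule is applied to
    [f] along the line through x in direction v, a function of one variable. *)
Lemma is_derive_diff_comp (U V W : normedModType R) (f : U -> V) (g : V -> W)
    (x v : U) (df : V) :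
    is_derive x v f df -> differentiable g (f x) ->
  is_derive x v (g \o f) ('d g (f x) df).
Proof.
move=> [dfx <-] dg.
pose c := fun h : R => f (h *: v + x).
have c0 : c 0 = f x by rewrite /c scale0r add0r.
have D1 (T : normedModType R) (k : U -> T) :
    'D_v k x = 'D_1 (fun h : R => k (h *: v + x)) 0.
  rewrite /derive; set d2 := (X in lim (X @ _) = _).
  suff -> : d2 = fun h : R =>
      h^-1 *: (((fun h : R => k (h *: v + x)) \o shift 0) (h *: 1) - k (0 *: v + x)).
    by [].
  by apply/funext => h; rewrite /d2 /= addr0 scale0r add0r [h *: 1]mulr1.
have dc : differentiable c 0 
  by apply/derivable1_diffP; exact: ((derivable1P _ _ _).1 dfx).
have dgc : differentiable (g \o c) 0.
  by apply: differentiable_comp => //; rewrite c0.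
split; first exact/derivable1P/derivable1_diffP.
rewrite (D1 _ f) [LHS](D1 _ (g \o f)) (deriveE _ dgc) (deriveE _ dc).
by rewrite diff_comp ?c0 //= c0.
Qed.

Lemma diff_coordE m n (F : 'rV[R]_m -> 'rV[R]_n) p v a : differentiable F p ->
  'D_v (fun y => F y 0 a) p = (v *m 'J F p) 0 a.
Proof.
move=> dF; rewrite -deriveEjacobian // derive_mx ?mxE //.
exact: diff_derivable.
Qed.

Lemma differentiable_coord_comp m n (F : 'rV[R]_m -> 'rV[R]_n) p a :
  differentiable F p -> differentiable (fun y => F y 0 a) p.
Proof.
by move=> dF; apply: (@differentiable_comp _ _ _ _ F (fun M => M 0 a)) => //;
  exact: differentiable_coord.
Qed.

Lemma C1_scalar_comp n (phi : 'rV[R]_n -> 'rV[R]_n) (Df : 'rV[R]_n -> 'M[R]_n)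
    (F : 'rV[R]_n -> 'rV[R]_n) a :
    {within closed_cube R n, continuous Df} ->
    (forall x, closed_cube R n x -> frechet_within phi Df x) ->
    (forall p, differentiable F p) -> continuous (fun p => 'J F p) ->
  C1_scalar (fun y => F (phi y) 0 a) (fun k y => (Df y *m 'J F (phi y)) k a).
Proof.
move=> cDf fphi dF cJ; split.
- apply/subspace_continuousP => x cx.
  have := frechet_within_cvg (fphi x cx) => cphi.
  have cF := differentiable_continuous (differentiable_coord_comp a (dF (phi x))).
  exact: (@cvg_comp _ _ _ phi (fun y => F y 0 a) _ _ _ cphi cF).
- move=> k.
  have -> : (fun y => (Df y *m 'J F (phi y)) k a) =
      (fun y => \sum_b Df y k b * 'J F (phi y) b a).
    by apply/funext => y; rewrite mxE.
  apply/subspace_continuousP => x cx.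
  have := frechet_within_cvg (fphi x cx) => cphi.
  apply: (@cvg_big _ _ (fun x y : R => x + y)) => [|b _]; first exact: add_continuous.
  apply: cvgM.
    have /subspace_continuousP/(_ x cx) cx' := cDf.
    exact: (@cvg_comp _ _ _ Df (fun M => M k b) _ _ _ cx'
      (@coord_continuous R n n k b _)).
  have cJ' := @cvg_comp _ _ _ phi (fun p => 'J F p) _ _ _ cphi (cJ (phi x)).
  exact: (@cvg_comp _ _ _ (fun y => 'J F (phi y)) (fun M => M b a) _ _ _ cJ'
    (@coord_continuous R n n b a _)).
move=> k x cx xk; have dphi := frechet_within_is_derive (fphi x cx) cx xk.
have dFa := differentiable_coord_comp a (dF (phi x)).
have := is_derive_diff_comp dphi dFa.
by rewrite -deriveE // diff_coordE // -row_mul mxE.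
Qed.
End composition.

(** * The normal component *)

Section normal_component.
Context (R : realType) (n : nat) (i : 'I_n.+1) (T : 'I_n.+1 -> 'rV[R]_n.+1).
Implicit Types u v : 'rV[R]_n.+1.

Let frame u : 'M[R]_n.+1 := \matrix_(k, c) (if k == i then u else T k) 0 c.

Lemma det_frame u : \det (frame u) = wedge (fun k => if k == i then u else T k).
Proof. by rewrite -det_tr; congr (\det _); apply/matrixP => a k; rewrite !mxE. Qed.

Let gram := \det (\matrix_(a < n, b < n) dotr (T (lift i a)) (T (lift i b))).

(** The product of the two determinants is that of the matrix of all inner products. Orthogonality
    clears its column i except at (i, i), and the complementary minor is the Gram determinant. *)
Lemma wedgeM_normal u v : (forall k, k != i -> dotr v (T k) = 0) ->
  wedge (fun k => if k == i then u else T k) *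
  wedge (fun k => if k == i then v else T k) = dotr u v * gram.
Proof.
move=> vT; rewrite -!det_frame -[\det (frame v)]det_tr -det_mulmx.
have E k l : (frame u *m (frame v)^T) k l =
    dotr (if k == i then u else T k) (if l == i then v else T l).
  by rewrite mxE; apply: eq_bigr => c _; rewrite !mxE.
rewrite (expand_det_col _ i) (bigD1 i) //= E eqxx big1 => [|k ki].
  rewrite addr0 /cofactor -signr_odd addnn odd_double expr0 mul1r.
  congr (_ * \det _); apply/matrixP => a b; rewrite mxE mxE E !mxE.
  by rewrite ![lift i _ == i]eq_sym !(negPf (neq_lift _ _)).
rewrite E eqxx (negPf ki) /dotr.
by under eq_bigr do rewrite mulrC; rewrite [X in X * _](vT k ki) mul0r.
Qed.

(** Taking u = v above shows that the Gram determinant is the square of the wedge with v, and one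
    factor cancels if it is nonzero. At a singular point a kernel vector of [frame v] has i-th
    coordinate 0, as pairing with v shows; hence it also kills [frame u], and both sides are 0. *)
Lemma wedge_normal u v :
    dotr v v = 1 -> (forall k, k != i -> dotr v (T k) = 0) ->
  wedge (fun k => if k == i then u else T k) =
  dotr u v * wedge (fun k => if k == i then v else T k).
Proof.
move=> vv vT; have Mu := wedgeM_normal u vT; have Mv := wedgeM_normal v vT.
rewrite vv mul1r in Mv; rewrite -Mv mulrA in Mu.
have [w0|w0] := eqVneq (wedge (fun k => if k == i then v else T k)) 0; last first.
  exact: mulIf w0 _ _ Mu.
rewrite w0 mulr0 -det_frame; apply/eqP/det0P.
have /eqP/det0P[x x0 xv] : \det (frame v) = 0 by rewrite det_frame.
exists x => //; have xi : x 0 i = 0.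
  have : (x *m frame v *m v^T) 0 0 = 0 by rewrite xv mul0mx mxE.
  rewrite -mulmxA mxE (bigD1 i) //= big1 => [|k ki].
    rewrite addr0 mxE (eq_bigr (fun c => v 0 c * v 0 c)) => [|c _].
      by rewrite -/(dotr v v) vv mulr1.
    by rewrite !mxE eqxx.
  rewrite mxE (eq_bigr (fun c => v 0 c * T k 0 c)) => [|c _].
    by rewrite -/(dotr v (T k)) vT // mulr0.
  by rewrite !mxE (negPf ki) mulrC.
rewrite -xv; apply/rowP => c; rewrite !mxE; apply: eq_bigr => k _.
by rewrite !mxE; case: (eqVneq k i) => [->|//]; rewrite xi !mul0r.
Qed.

(** The area density is the absolute value of the wedge with v; the outward condition fixes the sign
    of this wedge. *)
Lemma normal_component_area (s : bool) u v :
    dotr v v = 1 -> (forall k, k != i -> dotr v (T k) = 0) ->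
    (let w := wedge (fun k => if k == i then v else T k) in
     if s then 0 <= w else w <= 0) ->
  dotr u v * Num.sqrt gram =
  (-1) ^+ (~~ s) * wedge (fun k => if k == i then u else T k).
Proof.
move=> vv vT w0; rewrite (wedge_normal u vv vT).
have := wedgeM_normal v vT; rewrite vv mul1r => <-.
rewrite -expr2 sqrtr_sqr mulrCA; congr (_ * _); case: s w0 => /= w0.
  by rewrite ger0_norm // mul1r.
by rewrite ler0_norm // expr1 mulN1r.
Qed.

Lemma wedge_cofactor u (M : 'M[R]_n.+1) :
    (forall k, k != i -> row k M = T k) ->
  wedge (fun k => if k == i then u else T k) = \sum_a u 0 a * cofactor M i a.
Proof.
move=> MT; rewrite -det_frame (expand_det_row _ i); apply: eq_bigr => a _.
rewrite mxE eqxx; congr (_ * (_ * \det _)); apply/matrixP => k b; rewrite !mxE.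
by rewrite eq_sym (negPf (neq_lift _ _)) -MT ?mxE // eq_sym neq_lift.
Qed.
End normal_component.

(** * Determinants with one column replaced *)

Section column_replacement.
Context (R : comNzRingType) (n : nat) (A : 'M[R]_n) (a : 'I_n).

Lemma cofactor_replace_col (c : 'I_n -> R) i :
  cofactor (\matrix_(k < n, b < n) (if b == a then c k else A k b)) i a =
    cofactor A i a.
Proof.
congr (_ * \det _); apply/matrixP => k b; rewrite !mxE.
by rewrite eq_sym (negPf (neq_lift _ _)).
Qed.

(** The new column combines the columns b of [A] with coefficients [B b a]; for b != a a column is
    repeated, which appears here as an off-diagonal entry of [\adj A *m A]. With [B] the Jacobian
    matrix of [F], summing over a produces the divergence. *)
Lemma det_replace_col_mul (B : 'M[R]_n) :
  \det (\matrix_(k, b) (if b == a then (A *m B) k a else A k b)) =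
  B a a * \det A.
Proof.
rewrite (expand_det_col _ a).
under eq_bigr do rewrite mxE eqxx cofactor_replace_col mxE mulr_suml.
rewrite exchange_big /= (bigD1 a) //= [X in _ + X]big1 => [|b ba].
  rewrite addr0 (expand_det_col A a) mulr_sumr.
  by apply: eq_bigr => k _; ring.
have := congr1 (fun M : 'M[R]_n => M a b) (mul_adj_mx A).
rewrite !mxE eq_sym (negPf ba) mulr0n => E.
transitivity (B b a * \sum_j (\adj A) a j * A j b); last by rewrite E mulr0.
rewrite mulr_sumr; apply: eq_bigr => k _.
by rewrite !mxE; ring.
Qed.
End column_replacement.

(** * The flux through the faces of the cycle *)

Section cycle.
Context (R : realType) (n : nat).
Local Notation mu := (lebesgue_tuple R).
Context (phi F : 'rV[R]_n.+1 -> 'rV[R]_n.+1) (Df : 'rV[R]_n.+1 -> 'M[R]_n.+1).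

Lemma jacobian_id p : 'J (@id 'rV[R]_n.+1) p = 1%:M.
Proof.
apply/row_matrixP => k; rewrite !rowE mulmx1 -deriveEjacobian //.
by rewrite derive_id.
Qed.

Lemma divergence_jacobian p : differentiable F p ->
  divergence F p = \sum_a 'J F p a a.
Proof. by move=> dF; apply: eq_bigr => a _; rewrite diff_coordE // -rowE mxE. Qed.

(** Only the rows k != i of [Df z] are compared with partial derivatives of [phi]; these directions
    are tangential to the face. *)
Lemma face_integrand nS (i : 'I_n.+1) s z : outward_normal phi nS ->
    closed_cube R n.+1 z -> frechet_within phi Df z -> open_face i s z ->
  dotr (F (phi z)) (nS z) * area_density phi i z =
  (-1) ^+ (~~ s) * \sum_a F (phi z) 0 a * cofactor (Df z) i a.
Proof.
move=> nSP cz fz face; have [n1 nT ns] := nSP i s z face.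
rewrite /area_density (@normal_component_area _ _ i (partial phi ^~ z) s) //.
congr (_ * _); apply: wedge_cofactor => k ki.
have [_ /(_ k ki) zk] := face.
by have [_] := frechet_within_is_derive fz cz zk.
Qed.

(* Stokes for the map [phi] with its a-th component replaced by the a-th
   component of [F \o phi]. *)
Lemma stokes_component a :
    {within closed_cube R n.+1, continuous Df} ->
    (forall x, closed_cube R n.+1 x -> frechet_within phi Df x) ->
    (forall p, differentiable F p) -> continuous (fun p => 'J F p) ->
  let g x := 'J F (phi x) a a * \det (Df x) in
  let f (i : 'I_n.+1) z := F (phi z) 0 a * cofactor (Df z) i a in
  let flux i s := \int[mu n]_(t in unit_cube R n) f i (face_point i s t) in
  [/\ (mu n.+1).-integrable (unit_cube R n.+1) (EFin \o (fun t => g (row_tuple t))),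
      forall i s, (mu n).-integrable (unit_cube R n)
        (EFin \o (fun t => f i (face_point i s t))) &
      \int[mu n.+1]_(t in unit_cube R n.+1) g (row_tuple t) =
      \sum_i (flux i true - flux i false)].
Proof.
move=> cDf fphi F_diff F_C1 g f flux.
(* Every component of the modified map has the form [G b \o phi], so one chain rule serves for all
   of them. *)
pose G b : 'rV[R]_n.+1 -> 'rV[R]_n.+1 := if b == a then F else id.
pose u b y := G b (phi y) 0 b.
pose Du b k y := (Df y *m 'J (G b) (phi y)) k b.
have uC b : C1_scalar (u b) (Du b).
  have GD p : differentiable (G b) p by rewrite /G; case: (b == a).
  have GC : continuous (fun p => 'J (G b) p).
    rewrite /G; case: (b == a); first exact: F_C1.
    have -> : (fun p => 'J (@id 'rV[R]_n.+1) p) = cst 1%:M.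
      by apply/funext => p; exact: jacobian_id.
    exact: cst_continuous.
  exact: (@C1_scalar_comp R n.+1 phi Df (G b) b cDf fphi GD GC).
have ME y : \matrix_(k, b) Du b k y = \matrix_(k < n.+1, b < n.+1)
    (if b == a then (Df y *m 'J F (phi y)) k a else Df y k b).
  apply/matrixP => k b; rewrite [LHS]mxE [RHS]mxE /Du /G.
  by case: (eqVneq b a) => [->|_] //; rewrite jacobian_id mulmx1.
have [intM intf E] := stokes a uC.
pose M x : 'M[R]_n.+1 := \matrix_(k, b) Du b k x.
have gE : (fun t : n.+1.-tuple (measurableTypeR R) => g (row_tuple t)) =
    fun t => \det (M (row_tuple t)).
  by apply/funext => t; rewrite /M ME det_replace_col_mul.
have fE i s : (fun t : n.-tuple (measurableTypeR R) => f i (face_point i s t)) =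
    fun t => u a (face_point i s t) * cofactor (M (face_point i s t)) i a.
  by apply/funext => t; rewrite /M ME cofactor_replace_col /u /G eqxx.
rewrite gE; split; [exact: intM|by move=> i s; rewrite fE; exact: intf|].
by rewrite [LHS]E; apply: eq_bigr => i _; rewrite /flux !fE.
Qed.
End cycle.

Theorem theorem3p14 (R : realType) (m : nat) (m_ge2 : (2 <= m)%N)
    (phi : 'rV[R]_m -> 'rV[R]_m) (phi_C1 : C1_on (closed_cube R m) phi)
    (nS : 'rV[R]_m -> 'rV[R]_m) (nS_normal : outward_normal phi nS)
    (F : 'rV[R]_m -> 'rV[R]_m)
    (F_diff : forall p, differentiable F p)
    (F_C1 : continuous (fun p => 'J F p)) :
  cycle_flux phi nS F =
  \int[lebesgue_tuple R m]_(t in unit_cube R m)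
    (let x := row_tuple t in divergence F (phi x) * \det ('J phi x)).
Proof.
case: m m_ge2 phi phi_C1 nS nS_normal F F_diff F_C1 => // n _ phi [Df [cDf fphi]].
move=> nS nSP F F_diff F_C1.
have S a := stokes_component a cDf fphi F_diff F_C1.
pose f (a i : 'I_n.+1) (z : 'rV[R]_n.+1) := F (phi z) 0 a * cofactor (Df z) i a.
pose g a (x : 'rV[R]_n.+1) := 'J F (phi x) a a * \det (Df x).
(* [Df] agrees with the Jacobian matrix of [phi] on the open cube, which is all that the volume
   integral sees. *)
transitivity (\int[lebesgue_tuple R n.+1]_(t in unit_cube R n.+1)
    (\sum_a g a (row_tuple t))); last first.
  apply: eq_Rintegral => t; rewrite inE => t01.
  have cx := row_tuple_closed_cube t01.
  have [|_ JE] := frechet_within_differentiable (fphi _ cx).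
    by move=> k; rewrite row_tupleE; exact: t01.
  by rewrite /= JE divergence_jacobian // mulr_suml.
rewrite (Rintegral_sum _ _).2 => [|a]; last by have [] := S a.
under [RHS]eq_bigr => a _ do have [_ _ ->] := S a.
rewrite exchange_big; apply: eq_bigr => i _.
(* The sign is + on the face [s = true] and - on the opposite one, which reproduces the differences
   of fluxes in Stokes' identity. *)
have fluxE s : \int[lebesgue_tuple R n]_(t in unit_cube R n)
      (let z := face_point i s t in
       dotr (F (phi z)) (nS z) * area_density phi i z) =
    (-1) ^+ (~~ s) * \sum_a \int[lebesgue_tuple R n]_(t in unit_cube R n)
      f a i (face_point i s t).
  have intf a : (lebesgue_tuple R n).-integrable (unit_cube R n)
      (EFin \o (fun t => f a i (face_point i s t))).
    by have [_ intf _] := S a; exact: intf.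
  have [intsum <-] := Rintegral_sum (index_enum 'I_n.+1) intf.
  rewrite -RintegralZl //; last exact: measurable_unit_cube.
  apply: eq_Rintegral => t; rewrite inE => t01.
  have face := face_point_open_face i s t01.
  have cz := open_face_closed_cube face.
  exact: (face_integrand F nSP cz (fphi _ cz) face).
rewrite big_bool /= [X in X + _]fluxE [X in _ + X]fluxE expr0 expr1 mul1r mulN1r.
by rewrite -sumrB.
Qed.
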